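(* Let $m,\mathfrak{m}\in\mathbb{N}$, let $f\in L^2([0,1];\mathbb{C}^m)$ be $\mathfrak{m}$-Fourier bandlimited, let $0<\alpha<\beta<1$, let $N>\mathfrak{m}$ be an integer, and set $$\sigma=\frac{(N-\mathfrak{m})^{\beta}}{\sqrt{6}\,\pi},\qquad r=\frac{3\pi}{(N-\mathfrak{m})^{\alpha}}.$$ Define $$\mathcal{R}_{r,\sigma}f(x)=\sum_{j=0}^{2N-1} f(j/2N)\,s_N(x-j/2N)\,\mathcal{G}_{r,\sigma}(x-j/2N),\qquad x\in[0,1].$$ Then there exists $C>0$ such that, for all sufficiently large $N$, $$\|f-\mathcal{R}_{r,\sigma}f\|_{L^2([0,1];\mathbb{C}^m)}\le C\,\widetilde{\mathcal{E}}(N,\mathfrak{m},\alpha,\beta)\,\|f\|_{L^2([0,1];\mathbb{C}^m)},$$ where $$\widetilde{\mathcal{E}}(N,\mathfrak{m},\alpha,\beta)=e^{-3\pi^2(N-\mathfrak{m})^{2(1-\beta)}}\max\{1,(N-\mathfrak{m})^{2\beta-1}\}+(N-\mathfrak{m})^{\alpha+\beta}e^{-3\pi^2(N-\mathfrak{m})^{2(\beta-\alpha)}}.$$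
   Context: For $N\in\mathbb{N}$, $B_N=\{-N,-N+1,\dots,N-1\}\subset\mathbb{Z}$. Fourier coefficients of $f\in L^2([0,1];\mathbb{C}^m)$ are $\hat f(k)=\int_0^1 f(x)e^{-i2\pi kx}\,dx\in\mathbb{C}^m$. The function $f$ is $\mathfrak{m}$-Fourier bandlimited if $\hat f(k)=0$ for all $k\notin B_{\mathfrak{m}}$; such $f$ is identified with its continuous representative $\sum_{k\in B_{\mathfrak{m}}}\hat f(k)e^{i2\pi kx}$, regarded as a $1$-periodic function. The sampling function is $s_N(x)=\frac{1}{2N}\sum_{k=-N}^{N-1}e^{i2\pi kx}$. For $\sigma>0$, $\mathcal{G}_\sigma(x)=c(\sigma)\sum_{n\in\mathbb{Z}}e^{-n^2\sigma^{-2}/2}e^{i2\pi nx}$, where $c(\sigma)>0$ is the constant making $\mathcal{G}_\sigma(0)=1$. For $r\in(0,1/2)$, $\mathcal{G}_{r,\sigma}$ is the $1$-periodic function on $\mathbb{R}$ equal to $\mathcal{G}_\sigma(x)$ if $|x-k|\le r$ for some $k\in\mathbb{Z}$ and equal to $0$ otherwise. Arguments $x-j/2N$ are interpreted modulo $1$. *)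

(* Defs.v *)
From Stdlib Require Import Reals Lra ZArith List ClassicalEpsilon.
From Coquelicot Require Import Coquelicot.
Open Scope R_scope.

Definition csum (n : nat) (a : nat -> C) : C :=
  fold_right Cplus (RtoC 0) (map a (seq 0 n)).
Definition rsum (n : nat) (a : nat -> R) : R :=
  fold_right Rplus 0 (map a (seq 0 n)).

Definition cis (t : R) : C := (cos t, sin t).

Definition zpartial (a : Z -> C) (K : nat) : C :=
  csum (2 * K + 1) (fun i => a (Z.of_nat i - Z.of_nat K)%Z).
Definition zsum (a : Z -> C) : C :=
  (real (Lim_seq (fun K => fst (zpartial a K))),
   real (Lim_seq (fun K => snd (zpartial a K)))).

(* an m-vector in C^m is a family of components indexed by i < m *)
Definition bandlim (M : nat) (c : Z -> nat -> C) (x : R) (i : nat) : C :=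
  csum (2 * M) (fun l => let k := (Z.of_nat l - Z.of_nat M)%Z in
                         Cmult (c k i) (cis (2 * PI * IZR k * x))).

Definition sN (N : nat) (x : R) : C :=
  Cmult (RtoC (/ (2 * INR N)))
        (csum (2 * N) (fun l => cis (2 * PI * IZR (Z.of_nat l - Z.of_nat N)%Z * x))).

(* G_sigma(x) = c(sigma) sum_n e^{-n^2 sigma^-2 /2} e^{i 2 pi n x}, with G_sigma(0) = 1 *)
Definition gauss_series (sigma x : R) : C :=
  zsum (fun n => Cmult (RtoC (exp (- (IZR n)^2 / sigma^2 / 2))) (cis (2 * PI * IZR n * x))).
Definition csigma (sigma : R) : R := / fst (gauss_series sigma 0).
Definition Gsigma (sigma x : R) : C := Cmult (RtoC (csigma sigma)) (gauss_series sigma x).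

Definition Grsigma (r sigma x : R) : C :=
  if excluded_middle_informative (exists k : Z, Rabs (x - IZR k) <= r)
  then Gsigma sigma x else RtoC 0.

Definition recon (N : nat) (r sigma : R) (f : R -> nat -> C) (x : R) (i : nat) : C :=
  csum (2 * N) (fun j =>
    let xj := INR j / (2 * INR N) in
    Cmult (f xj i) (Cmult (sN N (x - xj)) (Grsigma r sigma (x - xj)))).

Definition L2norm (m : nat) (g : R -> nat -> C) : R :=
  sqrt (RInt (fun x => rsum m (fun i => (Cmod (g x i))^2)) 0 1).

Definition Etilde (N M : nat) (alpha beta : R) : R :=
  let d := INR N - INR M in
  exp (- 3 * PI^2 * Rpower d (2 * (1 - beta))) * Rmax 1 (Rpower d (2 * beta - 1))
  + Rpower d (alpha + beta) * exp (- 3 * PI^2 * Rpower d (2 * (beta - alpha))).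

(* Main.v *)
Require Import Defs.
From Stdlib Require Import Reals Lra Lia ZArith List ClassicalEpsilon.
From Coquelicot Require Import Coquelicot.
Open Scope R_scope.

(** Gaussian regularization multiplies the sampling kernel by the normalized theta
    series [G]. For the untruncated [G], expand it in its frequencies [n]: sampling
    [e^{2 pi i k x}] on the grid and interpolating reproduces the mode exactly whenever
    [k - n] lies in [B_N], hence for all [|n| <= N - M]; each other [n] contributes an
    error of modulus at most 2, so only the tail of the Gaussian coefficients is left.

    The truncation error is governed by the sharp decay of [G] in space. Instead of
    Poisson summation, it is obtained by Pólya's argument: [e^{-pi^2 tau j^2}] is the limit
    of [cos(pi j/L)^{2m}] with [m ~ tau L^2], and the discrete Fourier transform of the
    latter is [L/4^m] times the sum of the binomials [(2m choose i)] over a residue class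
    modulo [L]. These are dominated by
    [(2m choose m+u) <= (2m choose m) e^{-u^2/(m+u)}] and
    [(2m choose m)/4^m <= (2m+1)^{-1/2}]. Since [|s_N(y)| <= 1/(2N|y|)] for [|y| <= 1/2], summing over
    the [2N] nodes costs only a factor [1/r].

    All error bounds are pointwise, in terms of the absolute sum of the Fourier
    coefficients of [f], so the constant obtained depends on [f]. *)

(** * Finite sums, symmetric sums and complex limits *)

(** Everything is governed by tau = 3/(N-M)^{2 beta}, for which 1/(2 sigma^2) = pi^2 tau. The
    Gaussian coefficients beyond N - M start at e^{-pi^2 tau (N-M)^2}, the first exponential of the
    bound, and summing them costs 1/(tau (N-M)), that is (N-M)^{2 beta - 1} up to a constant. In
    space the theta series is bounded by a multiple of tau^{-1/2} e^{-y^2/tau}; at y = r this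
    exponent is the second one, and (N-M)^{alpha+beta} is 1/r times tau^{-1/2}, up to a constant.
    The spatial decay is due to cancellation, so no termwise estimate of the series can give it;
    Pólya's identity exposes it by turning an oscillating sum into a sum of nonnegative binomials. A
    second obstacle is that truncation creates jumps, while comparing values of [RInt] requires
    integrability. The squared error is therefore shown to be integrable separately, by cutting
    [0,1] at finitely many points. *)

Lemma csum_S n a : csum (S n) a = Cplus (csum n a) (a n).
Proof.
unfold csum. rewrite seq_S, map_app, fold_right_app. simpl.
generalize (map a (seq 0 n)). induction l as [|x l IH]; simpl.
- rewrite Cplus_0_r, Cplus_0_l; reflexivity.
- rewrite IH. ring.
Qed.

Lemma rsum_S n a : rsum (S n) a = rsum n a + a n.
Proof.
unfold rsum. rewrite seq_S, map_app, fold_right_app. simpl.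
generalize (map a (seq 0 n)). induction l as [|x l IH]; simpl.
- ring.
- rewrite IH. ring.
Qed.

Lemma csum_ext n a b : (forall i, (i < n)%nat -> a i = b i) -> csum n a = csum n b.
Proof.
induction n as [|n IH]; intros H; [reflexivity|].
rewrite !csum_S, IH, H; auto.
Qed.

Lemma rsum_ext n a b : (forall i, (i < n)%nat -> a i = b i) -> rsum n a = rsum n b.
Proof.
induction n as [|n IH]; intros H; [reflexivity|].
rewrite !rsum_S, IH, H; auto.
Qed.

Lemma csum_plus n a b : csum n (fun i => Cplus (a i) (b i)) = Cplus (csum n a) (csum n b).
Proof.
induction n as [|n IH]; [unfold csum; simpl; ring|].
rewrite !csum_S, IH; ring.
Qed.

Lemma csum_minus n a b : csum n (fun i => Cminus (a i) (b i)) = Cminus (csum n a) (csum n b).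
Proof.
induction n as [|n IH]; [unfold csum; simpl; ring|].
rewrite !csum_S, IH; ring.
Qed.

Lemma csum_scal n z a : csum n (fun i => Cmult z (a i)) = Cmult z (csum n a).
Proof.
induction n as [|n IH]; [unfold csum; simpl; ring|].
rewrite !csum_S, IH; ring.
Qed.

Lemma csum_0 n : csum n (fun _ => RtoC 0) = RtoC 0.
Proof.
induction n as [|n IH]; [reflexivity|].
rewrite csum_S, IH; ring.
Qed.

Lemma csum_swap n p (a : nat -> nat -> C) :
  csum n (fun i => csum p (fun j => a i j)) = csum p (fun j => csum n (fun i => a i j)).
Proof.
induction n as [|n IH].
- symmetry; apply csum_0.
- rewrite csum_S, IH, <- csum_plus. apply csum_ext; intros; rewrite csum_S; reflexivity.
Qed.

Lemma csum_head n a : csum (S n) a = Cplus (a 0%nat) (csum n (fun i => a (S i))).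
Proof.
induction n as [|n IH]; [unfold csum; simpl; ring|].
rewrite csum_S, IH, csum_S; ring.
Qed.

Lemma csum_single n (l0 : nat) a : (l0 < n)%nat ->
  (forall i, (i < n)%nat -> i <> l0 -> a i = RtoC 0) -> csum n a = a l0.
Proof.
induction n as [|n IH]; intros Hl H; [lia|].
rewrite csum_S.
destruct (Nat.eq_dec l0 n) as [->|Hne].
- rewrite (csum_ext n a (fun _ => RtoC 0)), csum_0; [ring|].
  intros i Hi; apply H; lia.
- rewrite IH, (H n); try lia; [ring|].
  intros i Hi; apply H; lia.
Qed.

Lemma rsum_plus n a b : rsum n (fun i => a i + b i) = rsum n a + rsum n b.
Proof.
induction n as [|n IH]; [unfold rsum; simpl; ring|].
rewrite !rsum_S, IH; ring.
Qed.

Lemma rsum_scal n z a : rsum n (fun i => z * a i) = z * rsum n a.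
Proof.
induction n as [|n IH]; [unfold rsum; simpl; ring|].
rewrite !rsum_S, IH; ring.
Qed.

Lemma rsum_const n z : rsum n (fun _ => z) = INR n * z.
Proof.
induction n as [|n IH]; [unfold rsum; simpl; ring|].
rewrite !rsum_S, IH, S_INR; ring.
Qed.

Lemma rsum_le n a b : (forall i, (i < n)%nat -> a i <= b i) -> rsum n a <= rsum n b.
Proof.
induction n as [|n IH]; intros H; [apply Rle_refl|].
rewrite !rsum_S; apply Rplus_le_compat; auto.
Qed.

Lemma rsum_pos n a : (forall i, (i < n)%nat -> 0 <= a i) -> 0 <= rsum n a.
Proof.
intros H. apply Rle_trans with (rsum n (fun _ => 0)).
- rewrite rsum_const; lra.
- apply rsum_le, H.
Qed.

Lemma rsum_swap n p (a : nat -> nat -> R) :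
  rsum n (fun i => rsum p (fun j => a i j)) = rsum p (fun j => rsum n (fun i => a i j)).
Proof.
induction n as [|n IH].
- transitivity (rsum p (fun _ => 0)); [rewrite rsum_const; unfold rsum; simpl; ring|reflexivity].
- rewrite rsum_S, IH, <- rsum_plus. apply rsum_ext; intros; rewrite rsum_S; reflexivity.
Qed.

Lemma rsum_head n a : rsum (S n) a = a 0%nat + rsum n (fun i => a (S i)).
Proof.
induction n as [|n IH]; [unfold rsum; simpl; ring|].
rewrite rsum_S, IH, rsum_S; ring.
Qed.

Lemma rsum_term_le n a l0 : (l0 < n)%nat -> (forall i, (i < n)%nat -> 0 <= a i) ->
  a l0 <= rsum n a.
Proof.
induction n as [|n IH]; intros Hl H; [lia|].
rewrite rsum_S.
destruct (Nat.eq_dec l0 n) as [->|Hne].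
- assert (0 <= rsum n a) by (apply rsum_pos; auto). lra.
- assert (a l0 <= rsum n a) by (apply IH; [lia|auto]). assert (0 <= a n) by auto. lra.
Qed.

Lemma Cmod_csum_le n a : Cmod (csum n a) <= rsum n (fun i => Cmod (a i)).
Proof.
induction n as [|n IH].
- unfold csum, rsum; simpl. rewrite Cmod_0; lra.
- rewrite csum_S, rsum_S. eapply Rle_trans; [apply Cmod_triangle|lra].
Qed.

Lemma csum_RtoC n (a : nat -> R) : csum n (fun i => RtoC (a i)) = RtoC (rsum n a).
Proof.
induction n as [|n IH]; [reflexivity|].
rewrite csum_S, rsum_S, IH, RtoC_plus; reflexivity.
Qed.

Definition rzpartial (a : Z -> R) (K : nat) : R :=
  rsum (2 * K + 1) (fun i => a (Z.of_nat i - Z.of_nat K)%Z).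

Lemma zpartial_S a K : zpartial a (S K) =
  Cplus (zpartial a K) (Cplus (a (Z.of_nat (S K))) (a (- Z.of_nat (S K))%Z)).
Proof.
unfold zpartial.
replace (2 * S K + 1)%nat with (S (S (2 * K + 1))) by lia.
rewrite csum_head, csum_S.
rewrite (csum_ext (2 * K + 1) _ (fun i => a (Z.of_nat i - Z.of_nat K)%Z)).
- replace (Z.of_nat 0 - Z.of_nat (S K))%Z with (- Z.of_nat (S K))%Z by lia.
  replace (Z.of_nat (S (2 * K + 1)) - Z.of_nat (S K))%Z with (Z.of_nat (S K)) by lia.
  ring.
- intros i _; f_equal; lia.
Qed.

Lemma rzpartial_S a K : rzpartial a (S K) =
  rzpartial a K + (a (Z.of_nat (S K)) + a (- Z.of_nat (S K))%Z).
Proof.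
unfold rzpartial.
replace (2 * S K + 1)%nat with (S (S (2 * K + 1))) by lia.
rewrite rsum_head, rsum_S.
rewrite (rsum_ext (2 * K + 1) _ (fun i => a (Z.of_nat i - Z.of_nat K)%Z)).
- replace (Z.of_nat 0 - Z.of_nat (S K))%Z with (- Z.of_nat (S K))%Z by lia.
  replace (Z.of_nat (S (2 * K + 1)) - Z.of_nat (S K))%Z with (Z.of_nat (S K)) by lia.
  ring.
- intros i _; f_equal; lia.
Qed.

Lemma zpartial_0 a : zpartial a 0 = a 0%Z.
Proof. unfold zpartial, csum; simpl. ring. Qed.

Lemma rzpartial_0 a : rzpartial a 0 = a 0%Z.
Proof. unfold rzpartial, rsum; simpl. ring. Qed.

Lemma zpartial_ext a b K :
  (forall n, (Z.abs n <= Z.of_nat K)%Z -> a n = b n) -> zpartial a K = zpartial b K.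
Proof. intros H. apply csum_ext; intros i Hi; apply H; lia. Qed.

Lemma zpartial_RtoC (a : Z -> R) K : zpartial (fun n => RtoC (a n)) K = RtoC (rzpartial a K).
Proof. apply csum_RtoC with (a := fun i => a (Z.of_nat i - Z.of_nat K)%Z). Qed.

Lemma Cmod_zpartial_le a K : Cmod (zpartial a K) <= rzpartial (fun n => Cmod (a n)) K.
Proof. apply Cmod_csum_le. Qed.

Lemma rzpartial_le a b K :
  (forall n, (Z.abs n <= Z.of_nat K)%Z -> a n <= b n) -> rzpartial a K <= rzpartial b K.
Proof. intros H. apply rsum_le; intros i Hi; apply H; lia. Qed.

Lemma zpartial_opp a K : zpartial (fun n => a (- n)%Z) K = zpartial a K.
Proof.
induction K as [|K IH].
- rewrite !zpartial_0; reflexivity.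
- rewrite !zpartial_S, IH, Z.opp_involutive; ring.
Qed.

(** A tail is written as a difference of symmetric partial sums, so that tail estimates stay finite
    and need no convergence. *)
Lemma zpartial_diff_le a K h : (K <= h)%nat ->
  Cmod (Cminus (zpartial a h) (zpartial a K)) <=
  rzpartial (fun n => Cmod (a n)) h - rzpartial (fun n => Cmod (a n)) K.
Proof.
induction 1 as [|h Hh IH].
- replace (Cminus _ _) with (RtoC 0) by ring. rewrite Cmod_0; lra.
- rewrite zpartial_S, rzpartial_S.
  set (u := a (Z.of_nat (S h))) in *. set (v := a (- Z.of_nat (S h))%Z) in *.
  replace (Cminus _ _) with (Cplus (Cminus (zpartial a h) (zpartial a K)) (Cplus u v)) by ring.
  eapply Rle_trans; [apply Cmod_triangle|].
  assert (Cmod (Cplus u v) <= Cmod u + Cmod v) by apply Cmod_triangle. lra.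
Qed.

(* [q/(1-q) * (q^K - q^h)] is the sum of [q^n] over [K < n <= h]. *)
Lemma rzpartial_geom_tail a B q K h : (K <= h)%nat -> 0 <= q < 1 ->
  (forall n, (Z.of_nat K < Z.abs n <= Z.of_nat h)%Z -> a n <= B * q ^ Z.abs_nat n) ->
  rzpartial a h - rzpartial a K <= 2 * B * (q / (1 - q)) * (q ^ K - q ^ h).
Proof.
intros Hh Hq H. induction Hh as [|h Hh IH]; [lra|].
rewrite rzpartial_S.
assert (IH' := IH ltac:(intros n Hn; apply H; lia)).
assert (H1 := H (Z.of_nat (S h)) ltac:(lia)).
assert (H2 := H (- Z.of_nat (S h))%Z ltac:(lia)).
replace (Z.abs_nat (Z.of_nat (S h))) with (S h) in H1 by lia.
replace (Z.abs_nat (- Z.of_nat (S h))) with (S h) in H2 by lia.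
replace (2 * B * (q / (1 - q)) * (q ^ K - q ^ S h))
  with (2 * B * (q / (1 - q)) * (q ^ K - q ^ h) + 2 * (B * q ^ S h)); [lra|].
simpl; field; lra.
Qed.

(** Componentwise, to match [zsum], which takes the limits of real and imaginary parts
    separately. *)
Definition climc (u : nat -> C) (l : C) : Prop :=
  is_lim_seq (fun n => fst (u n)) (fst l) /\ is_lim_seq (fun n => snd (u n)) (snd l).

Lemma climc_ext u v l : (forall n, u n = v n) -> climc u l -> climc v l.
Proof.
intros H [H1 H2]; split.
- eapply is_lim_seq_ext; [|exact H1]; intros n; simpl; rewrite H; reflexivity.
- eapply is_lim_seq_ext; [|exact H2]; intros n; simpl; rewrite H; reflexivity.
Qed.

Lemma climc_const z : climc (fun _ => z) z.
Proof. split; apply is_lim_seq_const. Qed.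

Lemma climc_plus u v l l' : climc u l -> climc v l' ->
  climc (fun n => Cplus (u n) (v n)) (Cplus l l').
Proof. intros [H1 H2] [H3 H4]; split; simpl; apply is_lim_seq_plus'; assumption. Qed.

Lemma climc_minus u v l l' : climc u l -> climc v l' ->
  climc (fun n => Cminus (u n) (v n)) (Cminus l l').
Proof.
intros [H1 H2] [H3 H4]; split; simpl.
- apply is_lim_seq_minus'; assumption.
- apply is_lim_seq_minus'; assumption.
Qed.

Lemma climc_mult u v l l' : climc u l -> climc v l' ->
  climc (fun n => Cmult (u n) (v n)) (Cmult l l').
Proof.
intros [H1 H2] [H3 H4]; split; simpl.
- apply is_lim_seq_minus'; apply is_lim_seq_mult'; assumption.
- apply is_lim_seq_plus'; apply is_lim_seq_mult'; assumption.
Qed.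

Lemma climc_RtoC u l : is_lim_seq u (Finite l) -> climc (fun n => RtoC (u n)) (RtoC l).
Proof. intros H; split; simpl; [exact H|apply is_lim_seq_const]. Qed.

Lemma climc_csum p (u : nat -> nat -> C) l : (forall j, (j < p)%nat -> climc (u j) (l j)) ->
  climc (fun n => csum p (fun j => u j n)) (csum p l).
Proof.
induction p as [|p IH]; intros H.
- apply climc_const.
- rewrite csum_S. apply climc_ext with (fun n => Cplus (csum p (fun j => u j n)) (u p n)).
  + intros n; rewrite csum_S; reflexivity.
  + apply climc_plus; auto.
Qed.

Lemma climc_Cmod u l : climc u l -> is_lim_seq (fun n => Cmod (u n)) (Cmod l).
Proof.
intros [H1 H2]. unfold Cmod.
apply (is_lim_seq_continuous sqrt).
- apply continuity_pt_sqrt. assert (0 <= (fst l)^2) by nra. assert (0 <= (snd l)^2) by nra. lra.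
- apply is_lim_seq_plus'.
  + simpl; apply is_lim_seq_mult'; [|apply is_lim_seq_mult']; auto; apply is_lim_seq_const.
  + simpl; apply is_lim_seq_mult'; [|apply is_lim_seq_mult']; auto; apply is_lim_seq_const.
Qed.

Lemma climc_Cmod_le u l v b : climc u l -> is_lim_seq v (Finite b) ->
  eventually (fun n => Cmod (u n) <= v n) -> Cmod l <= b.
Proof.
intros Hu Hv H.
exact (is_lim_seq_le_loc _ _ (Finite (Cmod l)) (Finite b) H (climc_Cmod _ _ Hu) Hv).
Qed.

Lemma ex_series_geom_bound (b : nat -> R) B q : 0 <= q < 1 ->
  (forall n, Rabs (b n) <= B * q ^ n) -> ex_series b.
Proof.
intros Hq H. apply (@ex_series_le R_AbsRing R_CompleteNormedModule) with (fun n => B * q ^ n); [exact H|].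
apply (@ex_series_scal R_AbsRing R_NormedModule).
apply ex_series_geom. rewrite Rabs_pos_eq; lra.
Qed.

Lemma real_zpartial_cv (a : Z -> R) B q : 0 <= q < 1 ->
  (forall n, Rabs (a n) <= B * q ^ Z.abs_nat n) -> ex_finite_lim_seq (rzpartial a).
Proof.
intros Hq H.
(* Folding n with -n counts [a 0] twice, hence the limit [l - a 0] below. *)
set (b := fun n => a (Z.of_nat n) + a (- Z.of_nat n)%Z).
destruct (ex_series_geom_bound b (2 * B) q Hq) as [l Hl].
- intros n. unfold b.
  assert (H1 := H (Z.of_nat n)). assert (H2 := H (- Z.of_nat n)%Z).
  replace (Z.abs_nat (Z.of_nat n)) with n in H1 by lia.
  replace (Z.abs_nat (- Z.of_nat n)) with n in H2 by lia.
  eapply Rle_trans; [apply Rabs_triang|lra].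
- exists (l - a 0%Z).
  apply is_lim_seq_ext with (fun n => sum_n b n - a 0%Z).
  + induction n as [|n IH].
    * rewrite sum_O, rzpartial_0. unfold b; simpl; ring.
    * rewrite sum_Sn, rzpartial_S, <- IH. unfold b, plus; simpl. ring.
  + apply is_lim_seq_minus'; [exact Hl|apply is_lim_seq_const].
Qed.

Lemma fst_csum n a : fst (csum n a) = rsum n (fun i => fst (a i)).
Proof. induction n as [|n IH]; [reflexivity|]. rewrite csum_S, rsum_S, <- IH; reflexivity. Qed.

Lemma snd_csum n a : snd (csum n a) = rsum n (fun i => snd (a i)).
Proof. induction n as [|n IH]; [reflexivity|]. rewrite csum_S, rsum_S, <- IH; reflexivity. Qed.

(** [zsum] is a total expression, meaningful only when the partial sums converge to a finite limit;
    geometric domination guarantees this. *)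
Lemma climc_zsum (a : Z -> C) B q : 0 <= q < 1 ->
  (forall n, Cmod (a n) <= B * q ^ Z.abs_nat n) -> climc (zpartial a) (zsum a).
Proof.
intros Hq H.
assert (Hs : forall l u, is_lim_seq u (Finite l) -> is_lim_seq u (real (Lim_seq u))).
{ intros l u Hu. rewrite (is_lim_seq_unique _ _ Hu). exact Hu. }
split; simpl.
- destruct (real_zpartial_cv (fun n => fst (a n)) B q Hq) as [l Hl].
  + intros n. eapply Rle_trans; [|apply H].
    eapply Rle_trans; [|apply Rmax_Cmod]. apply Rmax_l.
  + apply Hs with l. eapply is_lim_seq_ext; [|exact Hl].
    intros n; symmetry; apply fst_csum.
- destruct (real_zpartial_cv (fun n => snd (a n)) B q Hq) as [l Hl].
  + intros n. eapply Rle_trans; [|apply H].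
    eapply Rle_trans; [|apply Rmax_Cmod]. apply Rmax_r.
  + apply Hs with l. eapply is_lim_seq_ext; [|exact Hl].
    intros n; symmetry; apply snd_csum.
Qed.

(** * Sampling on the uniform grid *)

Lemma cis_plus a b : cis (a + b) = Cmult (cis a) (cis b).
Proof. unfold cis, Cmult; simpl. rewrite cos_plus, sin_plus. f_equal; ring. Qed.

Lemma cis_0 : cis 0 = RtoC 1.
Proof. unfold cis, RtoC. rewrite cos_0, sin_0; reflexivity. Qed.

Lemma Cmod_cis t : Cmod (cis t) = 1.
Proof.
unfold Cmod, cis; simpl. assert (H := sin2_cos2 t). unfold Rsqr in H.
rewrite <- sqrt_1 at 3. f_equal. lra.
Qed.

Lemma cis_2PI_IZR k : cis (2 * PI * IZR k) = RtoC 1.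
Proof.
assert (Hn : forall n : nat, cis (2 * PI * IZR (Z.of_nat n)) = RtoC 1).
{ induction n as [|n IH].
  - simpl; rewrite Rmult_0_r; apply cis_0.
  - rewrite Nat2Z.inj_succ, succ_IZR, Rmult_plus_distr_l, cis_plus, IH, Rmult_1_r.
    unfold cis. rewrite cos_2PI, sin_2PI. change (1, 0) with (RtoC 1). ring. }
destruct (Z_le_gt_dec 0 k) as [Hk|Hk].
- rewrite <- (Z2Nat.id k Hk). apply Hn.
- assert (H := Hn (Z.to_nat (- k))). rewrite Z2Nat.id in H by lia.
  transitivity (Cmult (cis (2 * PI * IZR k)) (cis (2 * PI * IZR (- k)))); [rewrite H; ring|].
  rewrite <- cis_plus, opp_IZR.
  replace (_ + _) with 0 by ring. apply cis_0.
Qed.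

Lemma cis_shift t s k : t - s = 2 * PI * IZR k -> cis t = cis s.
Proof.
intros H. replace t with (s + 2 * PI * IZR k) by lra.
rewrite cis_plus, cis_2PI_IZR; ring.
Qed.

Lemma Cmod_1_minus_cis t : Cmod (Cminus (RtoC 1) (cis t)) = 2 * Rabs (sin (t / 2)).
Proof.
replace (2 * Rabs (sin (t / 2))) with (Rabs (2 * sin (t / 2)))
  by (rewrite Rabs_mult, (Rabs_pos_eq 2); lra).
rewrite <- sqrt_Rsqr_abs. unfold Cmod; f_equal.
unfold cis, Rsqr; simpl.
replace t with (2 * (t / 2)) at 1 2 3 4 by field.
rewrite cos_2a, sin_2a.
assert (H := sin2_cos2 (t / 2)). unfold Rsqr in H.
set (x := sin (t / 2)) in *. set (y := cos (t / 2)) in *.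
replace (1 + - (y * y - x * x)) with (2 * (x * x)) by lra.
replace (y * y) with (1 - x * x) by lra.
ring_simplify. replace (y ^ 2) with (1 - x * x) by lra. ring.
Qed.

(** The product form avoids a division and so covers [cis t = 1] as well. *)
Lemma csum_geom n t :
  Cmult (Cminus (RtoC 1) (cis t)) (csum n (fun l => cis (INR l * t)))
  = Cminus (RtoC 1) (cis (INR n * t)).
Proof.
induction n as [|n IH].
- simpl. rewrite Rmult_0_l, cis_0. unfold csum; simpl; ring.
- rewrite csum_S, S_INR, Rmult_plus_distr_r, Rmult_1_l, cis_plus.
  transitivity (Cplus (Cmult (Cminus (RtoC 1) (cis t)) (csum n (fun l => cis (INR l * t))))
    (Cmult (Cminus (RtoC 1) (cis t)) (cis (INR n * t)))); [ring|].
  rewrite IH; ring.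
Qed.

(** Orthogonality of the characters of Z/L. If L does not divide z, then sin(t/2) is nonzero, so
    [1 - cis t] can be cancelled from the geometric sum identity, whose right side is 0. *)
Lemma csum_roots_unity (L : nat) (z : Z) : (0 < L)%nat ->
  csum L (fun j => cis (INR j * (2 * PI * IZR z / INR L))) =
  RtoC (if Z.eq_dec (z mod Z.of_nat L) 0 then INR L else 0).
Proof.
intros HL. assert (HL' : 0 < INR L) by (apply lt_0_INR; lia).
destruct (Z.eq_dec _ _) as [e|ne].
- apply Z.mod_divide in e; [|lia]. destruct e as [w ->].
  rewrite (csum_ext _ _ (fun _ => RtoC 1)).
  + rewrite (csum_RtoC L (fun _ => 1)), rsum_const, Rmult_1_r; reflexivity.
  + intros j _. rewrite <- (cis_2PI_IZR (Z.of_nat j * w)). f_equal.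
    rewrite !mult_IZR, <- !INR_IZR_INZ. field. lra.
- set (t := 2 * PI * IZR z / INR L).
  assert (H := csum_geom L t).
  replace (cis (INR L * t)) with (RtoC 1) in H.
  2: { rewrite <- (cis_2PI_IZR z). f_equal. unfold t; field; lra. }
  assert (Hne : Cminus (RtoC 1) (cis t) <> RtoC 0).
  { intros H0. assert (H1 := Cmod_1_minus_cis t). rewrite H0, Cmod_0 in H1.
    assert (Hs : sin (t / 2) = 0).
    { destruct (Req_dec (sin (t / 2)) 0) as [->|Hn]; [reflexivity|].
      apply Rabs_pos_lt in Hn; lra. }
    apply sin_eq_0_0 in Hs. destruct Hs as [k Hk].
    apply ne, Z.mod_divide; [lia|]. exists k. apply eq_IZR.
    rewrite mult_IZR, <- INR_IZR_INZ. unfold t in Hk.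
    assert (HP := PI_RGT_0).
    apply (Rmult_eq_reg_r (PI / INR L)).
    - transitivity (2 * PI * IZR z / INR L / 2); [field; lra|].
      rewrite Hk. field; lra.
    - apply Rgt_not_eq, Rdiv_lt_0_compat; lra. }
  replace (Cminus (RtoC 1) (RtoC 1)) with (RtoC 0) in H by ring.
  destruct (Ceq_dec (csum L (fun l => cis (INR l * t))) (RtoC 0)) as [E|E]; [exact E|].
  exfalso. exact (Cmult_neq_0 _ _ Hne E H).
Qed.

Definition reduce (N : nat) (q : Z) : Z :=
  ((q + Z.of_nat N) mod (2 * Z.of_nat N) - Z.of_nat N)%Z.

Lemma reduce_id N q : (- Z.of_nat N <= q < Z.of_nat N)%Z -> reduce N q = q.
Proof. intros H. unfold reduce. rewrite Z.mod_small; lia. Qed.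

(* On the grid the frequency [q] aliases to its representative in [{-N, ..., N-1}],
   which is reproduced exactly. *)
Lemma sN_interpolation (N : nat) (q : Z) (x : R) : (0 < N)%nat ->
  csum (2 * N) (fun j => Cmult (cis (2 * PI * IZR q * (INR j / (2 * INR N))))
                               (sN N (x - INR j / (2 * INR N))))
  = cis (2 * PI * IZR (reduce N q) * x).
Proof.
intros HN. assert (HN' : 0 < INR N) by (apply lt_0_INR; lia).
assert (H2N : INR (2 * N) = 2 * INR N) by (rewrite mult_INR; simpl; ring).
assert (Hp : (- Z.of_nat N <= reduce N q < Z.of_nat N)%Z).
{ unfold reduce. assert (H := Z.mod_pos_bound (q + Z.of_nat N) (2 * Z.of_nat N)). lia. }
assert (Hq : exists w, q = (reduce N q + w * (2 * Z.of_nat N))%Z).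
{ exists ((q + Z.of_nat N) / (2 * Z.of_nat N))%Z. unfold reduce.
  assert (H := Z.div_mod (q + Z.of_nat N) (2 * Z.of_nat N)). lia. }
set (p := reduce N q) in *. clearbody p. destruct Hq as [w ->].
(* After expanding [sN], the dependence on the node j is a character modulo 2N: the multiple w of 2N
   in the frequency only contributes w*j full turns there. *)
rewrite (csum_ext _ _ (fun j => Cmult (RtoC (/ (2 * INR N))) (csum (2 * N) (fun l =>
  Cmult (cis (2 * PI * IZR (Z.of_nat l - Z.of_nat N)%Z * x))
   (cis (INR j * (2 * PI * IZR (p - (Z.of_nat l - Z.of_nat N))%Z / INR (2 * N)))))))).
2: { intros j _. unfold sN. rewrite <- !csum_scal. apply csum_ext; intros l _.
  rewrite H2N.
  transitivity (Cmult (RtoC (/ (2 * INR N)))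
    (cis (2 * PI * IZR (p + w * (2 * Z.of_nat N)) * (INR j / (2 * INR N)) +
     2 * PI * IZR (Z.of_nat l - Z.of_nat N) * (x - INR j / (2 * INR N))))).
  { rewrite cis_plus; ring. }
  rewrite <- cis_plus. f_equal. apply cis_shift with (w * Z.of_nat j)%Z.
  rewrite !minus_IZR, plus_IZR, !mult_IZR, <- !INR_IZR_INZ. field. lra. }
rewrite csum_scal, csum_swap.
rewrite (csum_single _ (Z.to_nat (p + Z.of_nat N))).
- rewrite csum_scal, csum_roots_unity by lia.
  replace (Z.of_nat (Z.to_nat (p + Z.of_nat N)) - Z.of_nat N)%Z with p by lia.
  rewrite Z.sub_diag, Zmod_0_l. destruct (Z.eq_dec 0 0); [|lia].
  rewrite H2N, Cmult_comm, <- Cmult_assoc, <- RtoC_mult, Rinv_r by lra. ring.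
- lia.
- intros l Hl Hne. rewrite csum_scal, csum_roots_unity by lia.
  destruct (Z.eq_dec _ _) as [e|_]; [|ring].
  apply Z.mod_divide in e; [|lia]. destruct e as [v Hv]. exfalso.
  (* Both p and l - N lie in B_N, so their difference is smaller than 2N in modulus and can be a
     multiple of 2N only if it vanishes. *)
  replace (Z.of_nat (2 * N)) with (2 * Z.of_nat N)%Z in Hv by lia.
  assert (v = 0)%Z by nia. subst v. lia.
Qed.

(** The cubic Taylor bound x - x^3/6 gives x/3 as soon as x <= 2. The slope 1/3 is good enough
    because pi > 3 makes sin(pi y) >= y on [0,1/2]. *)
Lemma sin_ge_third x : 0 <= x <= PI / 2 -> x / 3 <= sin x.
Proof.
intros H. assert (HP := PI_4). assert (HP0 := PI_RGT_0).
destruct (pre_sin_bound x 0) as [H1 _]; try lra.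
unfold sin_approx, sin_term in H1; simpl in H1.
assert (x * x <= 4) by nra.
replace (1 * (x * 1 / 1) + -1 * 1 * (x * (x * (x * 1)) / (1 + 1 + 1 + 1 + 1 + 1)))
 with (x - x * (x * x) / 6) in H1 by field.
nra.
Qed.

Lemma Rabs_sin_PI_ge y : Rabs y <= / 2 -> Rabs y <= Rabs (sin (PI * y)).
Proof.
intros H. assert (HP := PI2_3_2).
assert (HP0 : 0 < PI) by lra.
assert (H0 : forall z, 0 <= z <= / 2 -> z <= sin (PI * z)).
{ intros z Hz. assert (PI * z / 3 <= sin (PI * z)) by (apply sin_ge_third; nra). nra. }
destruct (Rle_dec 0 y) as [Hy|Hy].
- rewrite Rabs_pos_eq in H by lra. rewrite (Rabs_pos_eq y) by lra.
  eapply Rle_trans; [apply H0; lra|apply Rle_abs].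
- rewrite Rabs_left in H by lra. rewrite (Rabs_left y) by lra.
  replace (PI * y) with (- (PI * - y)) by ring. rewrite sin_neg, Rabs_Ropp.
  eapply Rle_trans; [apply H0; lra|apply Rle_abs].
Qed.

(** The usual estimate of a Dirichlet kernel: the geometric sum has numerator at most 2 and
    denominator 2|sin(pi y)| >= 2|y|. *)
Lemma Cmod_sN_le (N : nat) y : (0 < N)%nat -> 0 < Rabs y <= / 2 ->
  Cmod (sN N y) <= / (2 * INR N * Rabs y).
Proof.
intros HN Hy. assert (HN' : 0 < INR N) by (apply lt_0_INR; lia).
unfold sN. rewrite Cmod_mult, Cmod_R, Rabs_pos_eq.
2: { apply Rlt_le, Rinv_0_lt_compat; lra. }
rewrite (Rinv_mult (2 * INR N) (Rabs y)). apply Rmult_le_compat_l.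
{ apply Rlt_le, Rinv_0_lt_compat; lra. }
(* Extracting a unimodular factor makes the frequencies start at 0. *)
rewrite (csum_ext _ _ (fun l => Cmult (cis (- (2 * PI * INR N * y))) (cis (INR l * (2 * PI * y))))).
2: { intros l _. rewrite <- cis_plus. f_equal. rewrite minus_IZR, <- !INR_IZR_INZ. ring. }
rewrite csum_scal, Cmod_mult, Cmod_cis, Rmult_1_l.
assert (H := f_equal Cmod (csum_geom (2 * N) (2 * PI * y))).
rewrite Cmod_mult, !Cmod_1_minus_cis in H.
replace (2 * PI * y / 2) with (PI * y) in H by field.
set (S := Cmod _) in *.
assert (Hs := Rabs_sin_PI_ge y ltac:(lra)).
assert (Hs1 : Rabs (sin (INR (2 * N) * (2 * PI * y) / 2)) <= 1)
  by (apply Rabs_le, SIN_bound).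
assert (HS : 0 <= S) by apply Cmod_ge_0.
assert (S * Rabs y <= 1) by nra.
apply Rmult_le_reg_r with (Rabs y); [lra|]. rewrite Rinv_l; lra.
Qed.

(** * Binomial sums over a residue class *)

Lemma exp_le x y : x <= y -> exp x <= exp y.
Proof.
intros [H| ->]; [apply Rlt_le, exp_increasing, H|apply Rle_refl].
Qed.

(** Pascal's rule makes the binomials vanish for k > n, so that the ratio recursion and the decay
    bound hold for every index. *)
Fixpoint bin (n k : nat) : R :=
  match n, k with
  | _, O => 1
  | O, S _ => 0
  | S n, S k => bin n k + bin n (S k)
  end.

Lemma bin_n_0 n : bin n 0 = 1.
Proof. destruct n; reflexivity. Qed.

Lemma bin_pos n k : 0 <= bin n k.
Proof.
revert k; induction n as [|n IH]; intros [|k]; simpl; try lra.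
assert (H1 := IH k). assert (H2 := IH (S k)). lra.
Qed.

Lemma bin_gt n k : (n < k)%nat -> bin n k = 0.
Proof.
revert k; induction n as [|n IH]; intros [|k] H; simpl; try lia; try reflexivity.
rewrite !IH by lia. ring.
Qed.

Lemma bin_ratio n k : INR (S k) * bin n (S k) = (INR n - INR k) * bin n k.
Proof.
revert k; induction n as [|n IH]; intros k.
- destruct k; simpl; ring.
- assert (H1 := IH k). rewrite !S_INR in *. destruct k as [|k].
  + simpl bin. rewrite bin_n_0 in *. simpl in *. lra.
  + assert (H2 := IH k). change (bin (S n) (S (S k))) with (bin n (S k) + bin n (S (S k))).
    change (bin (S n) (S k)) with (bin n k + bin n (S k)).
    rewrite !S_INR in *. lra.
Qed.

(** The binomial theorem for (1 + e^{it})^n, together with 1 + e^{it} = 2 cos(t/2) e^{it/2}: up to a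
    phase, the cosine power is the Fourier transform of the binomials. *)
Lemma bin_fourier n t :
  csum (S n) (fun i => Cmult (RtoC (bin n i)) (cis (INR i * t)))
  = Cmult (RtoC ((2 * cos (t / 2)) ^ n)) (cis (INR n * (t / 2))).
Proof.
induction n as [|n IH].
- unfold csum; simpl. rewrite !Rmult_0_l, cis_0. ring.
- assert (Hstep : csum (S (S n)) (fun i => Cmult (RtoC (bin (S n) i)) (cis (INR i * t)))
     = Cmult (Cplus (RtoC 1) (cis t))
        (csum (S n) (fun i => Cmult (RtoC (bin n i)) (cis (INR i * t))))).
  { assert (H : csum (S n) (fun i => Cmult (RtoC (bin n i)) (cis (INR i * t))) =
       Cplus (RtoC 1) (csum (S n) (fun i => Cmult (RtoC (bin n (S i))) (cis (INR (S i) * t))))).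
    { transitivity (csum (S (S n)) (fun i => Cmult (RtoC (bin n i)) (cis (INR i * t)))).
      - rewrite (csum_S (S n)), (bin_gt n (S n)) by lia. ring.
      - rewrite csum_head, bin_n_0. simpl (INR 0). rewrite Rmult_0_l, cis_0. ring. }
    transitivity (Cplus (csum (S n) (fun i => Cmult (RtoC (bin n i)) (cis (INR i * t))))
      (Cmult (cis t) (csum (S n) (fun i => Cmult (RtoC (bin n i)) (cis (INR i * t)))))); [|ring].
    rewrite H at 1. rewrite csum_head, <- csum_scal, <- Cplus_assoc, <- csum_plus.
    f_equal.
    - simpl. rewrite Rmult_0_l, cis_0. ring.
    - apply csum_ext; intros i _.
      change (bin (S n) (S i)) with (bin n i + bin n (S i)).
      rewrite (S_INR i), Rmult_plus_distr_r, Rmult_1_l, cis_plus, RtoC_plus. ring. }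
  rewrite Hstep, IH.
  assert (H : Cplus (RtoC 1) (cis t) = Cmult (RtoC (2 * cos (t / 2))) (cis (t / 2))).
  { unfold cis, Cplus, Cmult, RtoC; simpl.
    replace t with (2 * (t / 2)) at 1 2 by field.
    rewrite cos_2a_cos, sin_2a. f_equal; ring. }
  rewrite H, S_INR, Rmult_plus_distr_r, Rmult_1_l, cis_plus.
  change ((2 * cos (t / 2)) ^ S n) with (2 * cos (t / 2) * (2 * cos (t / 2)) ^ n).
  rewrite (RtoC_mult (2 * cos (t / 2)) (_ ^ n)). ring.
Qed.

(** The ratio of neighbouring binomials is (m-u)/(m+u+1) = 1 - (2u+1)/(m+u+1). With denominator m +
    u the increment of [psi] is at most (2u+1)/(m+u+1), so that one step of the recursion closes;
    for u much smaller than m the exponent is still close to u^2/m. *)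
Definition psi (m u : R) : R := u ^ 2 / (m + u).

(* The recursion [b' (m+u+1) = b (m-u)] holds for the binomials on both sides of the
   central one. *)
Lemma exp_psi_step m u B b b' : 0 < m -> 0 <= u -> 0 <= b -> b <= B * exp (- psi m u) ->
  b' * (m + u + 1) = b * (m - u) -> b' <= B * exp (- psi m (u + 1)).
Proof.
intros Hm Hu Hb Hle Heq.
assert (Hb' : b' = b * (1 - (2 * u + 1) / (m + u + 1))).
{ apply Rmult_eq_reg_r with (m + u + 1); [|lra]. rewrite Heq. field; lra. }
assert (H1 : 1 - (2 * u + 1) / (m + u + 1) <= exp (- ((2 * u + 1) / (m + u + 1)))).
{ eapply Rle_trans; [|apply exp_ineq1_le]. lra. }
assert (H2 : psi m (u + 1) <= psi m u + (2 * u + 1) / (m + u + 1)).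
{ unfold psi. replace ((u + 1) ^ 2 / (m + (u + 1))) with
    (u ^ 2 / (m + u + 1) + (2 * u + 1) / (m + u + 1)) by (field; lra).
  apply Rplus_le_compat_r. apply Rmult_le_compat_l; [nra|].
  apply Rinv_le_contravar; lra. }
assert (HB : 0 <= B).
{ assert (0 < exp (- psi m u)) by apply exp_pos. apply Rmult_le_reg_r with (exp (- psi m u)); lra. }
rewrite Hb'. apply Rle_trans with (B * exp (- psi m u) * exp (- ((2 * u + 1) / (m + u + 1)))).
- eapply Rle_trans; [apply Rmult_le_compat_l; [exact Hb|exact H1]|].
  apply Rmult_le_compat_r; [apply Rlt_le, exp_pos|exact Hle].
- rewrite Rmult_assoc, <- exp_plus. apply Rmult_le_compat_l; [exact HB|].
  apply exp_le; lra.
Qed.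

Lemma psi_0 m : psi m 0 = 0.
Proof. unfold psi, Rdiv; ring. Qed.

Lemma bin_decay_right m i : (0 < m)%nat ->
  bin (2 * m) (m + i) <= bin (2 * m) m * exp (- psi (INR m) (INR i)).
Proof.
intros Hm. assert (Hm' : 0 < INR m) by (apply lt_0_INR; lia).
induction i as [|i IH].
- simpl INR. rewrite psi_0, Ropp_0, exp_0, Nat.add_0_r; lra.
- rewrite (S_INR i), Nat.add_succ_r.
  apply exp_psi_step with (bin (2 * m) (m + i)); try apply pos_INR; try assumption.
  + apply bin_pos.
  + assert (H := bin_ratio (2 * m) (m + i)). rewrite S_INR, plus_INR, mult_INR in H. simpl (INR 2) in H. lra.
Qed.

Lemma bin_decay_left m i : (0 < m)%nat -> (i <= m)%nat ->
  bin (2 * m) (m - i) <= bin (2 * m) m * exp (- psi (INR m) (INR i)).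
Proof.
intros Hm Hi. assert (Hm' : 0 < INR m) by (apply lt_0_INR; lia).
induction i as [|i IH].
- simpl INR. rewrite psi_0, Ropp_0, exp_0, Nat.sub_0_r; lra.
- rewrite (S_INR i).
  apply exp_psi_step with (bin (2 * m) (m - i)); try apply pos_INR; try assumption.
  + apply bin_pos.
  + apply IH; lia.
  (* The ratio at k = m - i - 1 is read from right to left, stepping away from the centre. *)
  + assert (H := bin_ratio (2 * m) (m - S i)). replace (S (m - S i)) with (m - i)%nat in H by lia.
    rewrite mult_INR, (minus_INR m i), (minus_INR m (S i)), (S_INR i) in H by lia.
    simpl (INR 2) in H. lra.
Qed.

Lemma bin_decay m l : (0 < m)%nat ->
  bin (2 * m) l <= bin (2 * m) m * exp (- psi (INR m) (Rabs (INR l - INR m))).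
Proof.
intros Hm. destruct (le_ge_dec m l) as [H|H].
- rewrite <- minus_INR by lia. rewrite Rabs_pos_eq by apply pos_INR.
  replace (bin (2 * m) l) with (bin (2 * m) (m + (l - m))) by (f_equal; lia).
  apply bin_decay_right, Hm.
- rewrite Rabs_minus_sym, <- minus_INR by lia. rewrite Rabs_pos_eq by apply pos_INR.
  replace (bin (2 * m) l) with (bin (2 * m) (m - (m - l))) by (f_equal; lia).
  apply bin_decay_left; lia.
Qed.

(** A Wallis-type bound, squared to avoid roots: the left side decreases in m, consecutive values
    having ratio (2m+1)(2m+3)/(2m+2)^2 <= 1. *)
Lemma bin_central m : (bin (2 * m) m / 4 ^ m) ^ 2 * (2 * INR m + 1) <= 1.
Proof.
induction m as [|m IH].
- simpl. lra.
- assert (Hm := pos_INR m).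
  assert (Hrec : bin (2 * S m) (S m) * (INR m + 1) = 2 * (2 * INR m + 1) * bin (2 * m) m).
  { replace (2 * S m)%nat with (S (S (2 * m))) by lia.
    change (bin (S (S (2 * m))) (S m)) with (bin (S (2 * m)) m + bin (S (2 * m)) (S m)).
    assert (H1 := bin_ratio (S (2 * m)) m).
    assert (H2 := bin_ratio (2 * m) m).
    change (bin (S (2 * m)) (S m)) with (bin (2 * m) m + bin (2 * m) (S m)) in *.
    rewrite !S_INR, mult_INR in *. simpl (INR 2) in *. nra. }
  set (b := bin (2 * m) m) in *. set (b' := bin (2 * S m) (S m)) in *.
  assert (Hb' : b' / 4 ^ S m = (b / 4 ^ m) * ((2 * INR m + 1) / (2 * INR m + 2))).
  { replace b' with (2 * (2 * INR m + 1) * b / (INR m + 1)) by (rewrite <- Hrec; field; lra).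
    simpl. assert (4 ^ m <> 0) by (apply pow_nonzero; lra). field. repeat split; lra. }
  rewrite Hb', S_INR. set (x := b / 4 ^ m) in *.
  apply Rle_trans with (x ^ 2 * (2 * INR m + 1)); [|exact IH].
  replace ((x * ((2 * INR m + 1) / (2 * INR m + 2))) ^ 2 * (2 * (INR m + 1) + 1))
    with (x ^ 2 * (2 * INR m + 1) * ((2 * INR m + 1) * (2 * INR m + 3) / (2 * INR m + 2) ^ 2))
    by (field; lra).
  rewrite <- (Rmult_1_r (x ^ 2 * (2 * INR m + 1))) at 2.
  apply Rmult_le_compat_l; [nra|].
  apply Rle_div_l; [nra|nra].
Qed.

Lemma rsum_indicator n v w : 0 <= w ->
  rsum n (fun i => if Z.eq_dec (Z.of_nat i) v then w else 0) <= w.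
Proof.
intros Hw.
(* The bound by w alone is not inductive: the induction has to know whether v has already been
   met. *)
cut (rsum n (fun i => if Z.eq_dec (Z.of_nat i) v then w else 0) <=
  if Z_lt_dec v (Z.of_nat n) then w else 0).
{ destruct (Z_lt_dec _ _); lra. }
induction n as [|n IH].
- unfold rsum; simpl. destruct (Z_lt_dec v 0); lra.
- rewrite rsum_S.
  destruct (Z.eq_dec _ _); destruct (Z_lt_dec v (Z.of_nat n));
  destruct (Z_lt_dec v (Z.of_nat (S n))); try lia; lra.
Qed.

(** On the residue class the map from i to k = (i+z)/L is injective, so the sum can be reindexed by
    k; |k| <= n + |z| explains the witness. *)
Lemma rsum_residue_le (n L : nat) (z : Z) (W : Z -> R) : (0 < L)%nat -> (forall k, 0 <= W k) ->
  exists K, rsum n (fun i => if Z.eq_dec ((Z.of_nat i + z) mod Z.of_nat L) 0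
                   then W ((Z.of_nat i + z) / Z.of_nat L)%Z else 0) <= rzpartial W K.
Proof.
intros HL HW. exists (n + Z.abs_nat z)%nat. set (K := (n + Z.abs_nat z)%nat).
(* Double counting over the pairs (i, k) with i + z = kL: every i of the class has such a k, and
   every k has at most one i. *)
apply Rle_trans with (rsum n (fun i => rsum (2 * K + 1) (fun l =>
   if Z.eq_dec (Z.of_nat i) (Z.of_nat L * (Z.of_nat l - Z.of_nat K) - z)
   then W (Z.of_nat l - Z.of_nat K)%Z else 0))).
- apply rsum_le; intros i Hi. destruct (Z.eq_dec ((Z.of_nat i + z) mod Z.of_nat L) 0) as [e|_].
  + apply Z.mod_divide in e; [|lia]. destruct e as [k Hk].
    rewrite Hk, Z.div_mul by lia.
    assert (HkK : (Z.abs k <= Z.of_nat K)%Z) by (unfold K; nia).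
    set (l0 := Z.to_nat (k + Z.of_nat K)).
    eapply Rle_trans; [|apply (rsum_term_le _ _ l0)].
    * cbv beta. replace (Z.of_nat l0 - Z.of_nat K)%Z with k by (unfold l0; lia).
      destruct (Z.eq_dec _ _); [lra|nia].
    * unfold l0; lia.
    * intros l _. cbv beta. destruct (Z.eq_dec _ _); [apply HW|lra].
  + apply rsum_pos; intros l _. destruct (Z.eq_dec _ _); [apply HW|lra].
- rewrite rsum_swap. apply rsum_le; intros l _. apply rsum_indicator, HW.
Qed.

(** An odd L lets the frequencies be centred at 0, as in the symmetric sums of the theta series.
    Centring costs a phase, which is 1 when L divides z. *)
Lemma zpartial_roots_unity (h : nat) (z : Z) : let L := (2 * h + 1)%nat in
  zpartial (fun j => cis (2 * PI * IZR j * (IZR z / INR L))) h =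
  RtoC (if Z.eq_dec (z mod Z.of_nat L) 0 then INR L else 0).
Proof.
intros L. assert (HL' : 0 < INR L) by (apply lt_0_INR; unfold L; lia).
transitivity (Cmult (cis (- (2 * PI * INR h * (IZR z / INR L))))
   (csum L (fun j => cis (INR j * (2 * PI * IZR z / INR L))))).
- rewrite <- csum_scal. unfold zpartial. apply csum_ext; intros j _.
  rewrite <- cis_plus. f_equal. rewrite minus_IZR, <- !INR_IZR_INZ. field. lra.
- rewrite csum_roots_unity by (unfold L; lia).
  destruct (Z.eq_dec _ _) as [e|_]; [|ring].
  apply Z.mod_divide in e; [|unfold L; lia]. destruct e as [w ->].
  rewrite (cis_shift _ 0 (- (Z.of_nat h * w))), cis_0; [ring|].
  rewrite opp_IZR, !mult_IZR, <- !INR_IZR_INZ. field. lra.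
Qed.

(** Approximant of a theta term: an even power of the cosine stands for the Gaussian, and s/L for
    the position. *)
Definition polya_term (h m : nat) (s : Z) (j : Z) : C :=
  Cmult (RtoC (cos (PI * IZR j / INR (2 * h + 1)) ^ (2 * m)))
        (cis (2 * PI * IZR j * (IZR s / INR (2 * h + 1)))).

(** The cosine power is expanded by [bin_fourier] at t = 2 pi j/L, whose phase shifts the index by
    m; orthogonality in j then keeps the i congruent to m - s modulo L. *)
Lemma polya_identity (h m : nat) (s : Z) : let L := (2 * h + 1)%nat in
  zpartial (polya_term h m s) h =
  RtoC (INR L / 4 ^ m * rsum (S (2 * m)) (fun i =>
    if Z.eq_dec ((Z.of_nat i + (s - Z.of_nat m)) mod Z.of_nat L) 0 then bin (2 * m) i else 0)).
Proof.
intros L. assert (HL' : 0 < INR L) by (apply lt_0_INR; unfold L; lia).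
assert (H4 : 4 ^ m <> 0) by (apply pow_nonzero; lra).
transitivity (csum (2 * h + 1) (fun l => csum (S (2 * m)) (fun i =>
  Cmult (RtoC (bin (2 * m) i / 4 ^ m))
  (cis (2 * PI * IZR (Z.of_nat l - Z.of_nat h) * (IZR (Z.of_nat i + (s - Z.of_nat m)) / INR L)))))).
- apply csum_ext; intros l _. set (j := (Z.of_nat l - Z.of_nat h)%Z).
  unfold polya_term. fold L.
  set (t := 2 * (PI * IZR j / INR L)).
  assert (H := bin_fourier (2 * m) t).
  replace (t / 2) with (PI * IZR j / INR L) in H by (unfold t; field; lra).
  rewrite (csum_ext _ _ (fun i => Cmult (Cmult (RtoC (/ 4 ^ m))
     (cis (2 * PI * IZR j * (IZR (s - Z.of_nat m) / INR L)))) (Cmult (RtoC (bin (2 * m) i)) (cis (INR i * t))))).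
  + rewrite csum_scal, H, Rpow_mult_distr, (pow_mult 2 2 m).
    replace ((2 ^ 2) ^ m) with (4 ^ m) by (f_equal; ring).
    set (X := cos _ ^ _).
    transitivity (Cmult (Cmult (RtoC (/ 4 ^ m)) (RtoC (4 ^ m * X)))
      (Cmult (cis (2 * PI * IZR j * (IZR (s - Z.of_nat m) / INR L))) (cis (INR (2 * m) * (PI * IZR j / INR L))))); [|ring].
    rewrite <- RtoC_mult, <- cis_plus. f_equal; f_equal.
    * field. exact H4.
    * rewrite minus_IZR, <- INR_IZR_INZ, mult_INR. simpl (INR 2). field. lra.
  + intros i _. unfold Rdiv at 1. rewrite RtoC_mult.
    transitivity (Cmult (Cmult (RtoC (/ 4 ^ m)) (RtoC (bin (2 * m) i)))
      (Cmult (cis (2 * PI * IZR j * (IZR (s - Z.of_nat m) / INR L))) (cis (INR i * t)))); [|ring].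
    rewrite <- cis_plus.
    transitivity (Cmult (Cmult (RtoC (/ 4 ^ m)) (RtoC (bin (2 * m) i)))
     (cis (2 * PI * IZR j * (IZR (Z.of_nat i + (s - Z.of_nat m)) / INR L)))); [ring|].
    do 2 f_equal. unfold t. rewrite plus_IZR, <- INR_IZR_INZ. field. lra.
- rewrite csum_swap, <- rsum_scal, <- csum_RtoC. apply csum_ext; intros i _.
  rewrite csum_scal.
  assert (H := zpartial_roots_unity h (Z.of_nat i + (s - Z.of_nat m))). cbv zeta in H. fold L in H.
  unfold zpartial in H. fold L in H. fold L. rewrite H, <- RtoC_mult. f_equal.
  destruct (Z.eq_dec _ _); field; exact H4.
Qed.

(** In its second argument [psi] is increasing and grows at least linearly along rays from 0. This
    turns equally spaced distances into a geometric progression of exponentials. *)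
Lemma psi_scale m v lam u : 0 < m -> 0 <= v -> 1 <= lam -> lam * v <= u ->
  lam * psi m v <= psi m u.
Proof.
intros Hm Hv Hl Hu. unfold psi.
assert (0 <= lam * v) by nra.
apply Rle_trans with ((lam * v) ^ 2 / (m + lam * v)).
- replace (lam * (v ^ 2 / (m + v))) with ((lam * v) ^ 2 / (lam * (m + v))) by (field; lra).
  apply Rmult_le_compat_l; [nra|]. apply Rinv_le_contravar; nra.
- apply Rle_div_l; [lra|].
  set (w := lam * v) in *.
  apply Rmult_le_reg_r with (m + u); [lra|].
  replace (u ^ 2 / (m + u) * (m + w) * (m + u)) with (u ^ 2 * (m + w)) by (field; lra).
  (* This product equals u^2 (m+w) - w^2 (m+u), the cross-multiplied form of monotonicity. *)
  assert (0 <= (u - w) * (m * (u + w) + u * w)); [|lra].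
  apply Rmult_le_pos; [lra|]. assert (0 <= u * w) by nra. nra.
Qed.

(** The indices of the class lie at the distances |kL - s| from the centre m. The term k = 0 gives
    the main exponential; the others decay geometrically in |k| because s <= L/2. *)
Lemma polya_bound (h m : nat) (s : Z) : let L := INR (2 * h + 1) in
  (0 < m)%nat -> (0 <= s)%Z -> 2 * IZR s <= L ->
  Cmod (zpartial (polya_term h m s) h) <=
  L * (bin (2 * m) m / 4 ^ m) * exp (- psi (INR m) (IZR s)) *
  (1 + 2 / (1 - exp (- (2 * psi (INR m) (L / 2))))).
Proof.
intros L Hm Hs HsL.
assert (HL' : 0 < L) by (apply lt_0_INR; lia).
assert (Hm' : 0 < INR m) by (apply lt_0_INR; lia).
assert (Hs' : 0 <= IZR s) by (apply IZR_le; lia).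
assert (H4 : 0 < 4 ^ m) by (apply pow_lt; lra).
assert (Hb := bin_pos (2 * m) m).
set (E0 := exp (- psi (INR m) (IZR s))).
assert (HE0 : 0 < E0) by apply exp_pos.
set (Q := exp (- (2 * psi (INR m) (L / 2)))).
assert (HQ0 : 0 < Q) by apply exp_pos.
assert (HQ1 : Q < 1).
{ unfold Q. rewrite <- exp_0. apply exp_increasing.
  assert (0 < psi (INR m) (L / 2)); [|lra]. apply Rdiv_lt_0_compat; [nra|lra]. }
set (W := fun k : Z => if Z.eq_dec k 0 then E0 else E0 * Q ^ (Z.abs_nat k - 1)).
assert (HW : forall k, 0 <= W k).
{ intros k; unfold W. destruct (Z.eq_dec k 0); [lra|].
  apply Rmult_le_pos; [lra|]. apply pow_le; lra. }
destruct (rsum_residue_le (S (2 * m)) (2 * h + 1) (s - Z.of_nat m) W) as [K HK]; [lia|exact HW|].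
assert (HWK : rzpartial W K <= E0 * (1 + 2 / (1 - Q))).
(* The factor E0/Q compensates for the exponent |k| - 1 in [W], where the tail lemma has |k|. *)
{ assert (H := rzpartial_geom_tail W (E0 / Q) Q 0 K ltac:(lia) ltac:(lra)).
  rewrite rzpartial_0 in H. unfold W at 3 in H. simpl in H.
  assert (HQK : 0 <= Q ^ K) by (apply pow_le; lra).
  apply Rle_trans with (E0 + 2 * (E0 / Q) * (Q / (1 - Q)) * (1 - Q ^ K)).
  - assert (H' : rzpartial W K - E0 <= 2 * (E0 / Q) * (Q / (1 - Q)) * (1 - Q ^ K)); [|lra].
    apply H. intros n Hn. unfold W. destruct (Z.eq_dec n 0); [lia|].
    destruct (Z.abs_nat n) as [|p] eqn:Ep; [lia|].
    replace (S p - 1)%nat with p by lia. simpl. right. field. lra.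
  - replace (2 * (E0 / Q) * (Q / (1 - Q)) * (1 - Q ^ K)) with (2 * E0 / (1 - Q) * (1 - Q ^ K))
      by (field; lra).
    assert (0 <= 2 * E0 / (1 - Q)) by (apply Rlt_le, Rdiv_lt_0_compat; lra).
    replace (E0 * (1 + 2 / (1 - Q))) with (E0 + 2 * E0 / (1 - Q)) by (field; lra). nra. }
rewrite polya_identity, Cmod_R. fold L. fold Q.
rewrite Rabs_pos_eq.
2: { apply Rmult_le_pos; [apply Rlt_le, Rdiv_lt_0_compat; lra|].
  apply rsum_pos; intros i _. destruct (Z.eq_dec _ _); [apply bin_pos|lra]. }
apply Rle_trans with (L / 4 ^ m * (bin (2 * m) m * rzpartial W K)).
2: { replace (L * (bin (2 * m) m / 4 ^ m) * E0 * (1 + 2 / (1 - Q)))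
       with (L / 4 ^ m * (bin (2 * m) m * (E0 * (1 + 2 / (1 - Q))))) by (field; lra).
     apply Rmult_le_compat_l; [apply Rlt_le, Rdiv_lt_0_compat; lra|].
     apply Rmult_le_compat_l; assumption. }
apply Rmult_le_compat_l; [apply Rlt_le, Rdiv_lt_0_compat; lra|].
eapply Rle_trans; [|apply Rmult_le_compat_l; [exact Hb|exact HK]].
rewrite <- rsum_scal. apply rsum_le; intros i _.
destruct (Z.eq_dec _ _) as [e|_]; [|lra].
apply Z.mod_divide in e; [|lia]. destruct e as [k Hk].
rewrite Hk, Z.div_mul by lia.
eapply Rle_trans; [apply bin_decay, Hm|]. apply Rmult_le_compat_l; [exact Hb|].
assert (Hu : INR i - INR m = IZR k * L - IZR s).
{ unfold L. rewrite (INR_IZR_INZ (2 * h + 1)), <- mult_IZR, <- Hk, plus_IZR, minus_IZR, <- !INR_IZR_INZ. ring. }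
rewrite Hu. unfold W. destruct (Z.eq_dec k 0) as [->|Hk0].
- unfold E0. apply exp_le. right. do 2 f_equal. rewrite Rmult_0_l, Rabs_left1; lra.
- set (p := (Z.abs_nat k - 1)%nat).
  assert (Hp : Rabs (IZR k) = INR p + 1).
  { rewrite <- abs_IZR, <- S_INR, INR_IZR_INZ. f_equal. unfold p; lia. }
  assert (Hpow : Q ^ p = exp (- (2 * INR p * psi (INR m) (L / 2)))).
  { clear. induction p as [|p IH].
    - simpl. rewrite Rmult_0_r, Rmult_0_l, Ropp_0, exp_0; reflexivity.
    - rewrite S_INR. simpl pow. rewrite IH. unfold Q. rewrite <- exp_plus. f_equal. ring. }
  rewrite Hpow. unfold E0. rewrite <- exp_plus. apply exp_le.
  assert (Hp0 := pos_INR p).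
  (* With |k| = p + 1 and s <= L/2 one has |kL - s| >= (2p+1) L/2. One copy of psi(L/2) dominates
     psi(s), the remaining 2p give Q^p. *)
  assert (H1 : (1 + 2 * INR p) * psi (INR m) (L / 2) <= psi (INR m) (Rabs (IZR k * L - IZR s))).
  { apply psi_scale; try lra.
    assert (Rabs (IZR k * L) - Rabs (IZR s) <= Rabs (IZR k * L - IZR s)) by apply Rabs_triang_inv.
    rewrite Rabs_mult, Hp, (Rabs_pos_eq L), (Rabs_pos_eq (IZR s)) in H by lra. lra. }
  assert (H2 : 1 * psi (INR m) (IZR s) <= psi (INR m) (L / 2)) by (apply psi_scale; lra).
  lra.
Qed.

(** * Gaussian decay of the theta series *)

Lemma zsum_ext a b : (forall K, zpartial a K = zpartial b K) -> zsum a = zsum b.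
Proof.
intros H. unfold zsum.
f_equal; f_equal; apply Lim_seq_ext; intros K; rewrite H; reflexivity.
Qed.

Definition theta_term (a y : R) (n : Z) : C :=
  Cmult (RtoC (exp (- (a * IZR n ^ 2)))) (cis (2 * PI * IZR n * y)).
Definition theta (a y : R) : C := zsum (theta_term a y).

Lemma Cmod_theta_term a y n : Cmod (theta_term a y n) = exp (- (a * IZR n ^ 2)).
Proof.
unfold theta_term. rewrite Cmod_mult, Cmod_cis, Cmod_R, Rmult_1_r.
apply Rabs_pos_eq, Rlt_le, exp_pos.
Qed.

(** Combines 1 + x <= e^x with 2x - a x^2 <= 1/a, a completed square. The factor 1 + |n| serves the
    Lipschitz estimate of the theta series. *)
Lemma gauss_linear_le_geom a n : 0 < a ->
  (1 + Rabs (IZR n)) * exp (- (a * IZR n ^ 2)) <= exp (/ a) * exp (- 1) ^ Z.abs_nat n.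
Proof.
intros Ha.
assert (Hp : exp (- 1) ^ Z.abs_nat n = exp (- Rabs (IZR n))).
{ rewrite <- abs_IZR, <- Zabs2Nat.id_abs, <- INR_IZR_INZ.
  generalize (Z.abs_nat n); intros p; induction p as [|p IH].
  - simpl; rewrite Ropp_0, exp_0; reflexivity.
  - rewrite S_INR; simpl pow; rewrite IH, <- exp_plus; f_equal; ring. }
rewrite Hp, <- exp_plus.
replace (IZR n ^ 2) with (Rabs (IZR n) ^ 2) by (apply pow2_abs).
set (x := Rabs (IZR n)).
apply Rle_trans with (exp x * exp (- (a * x ^ 2))).
- apply Rmult_le_compat_r; [apply Rlt_le, exp_pos|apply exp_ineq1_le].
- rewrite <- exp_plus. apply exp_le.
  assert (0 <= (a * x - 1) ^ 2 / a).
  { apply Rmult_le_pos; [apply pow2_ge_0|apply Rlt_le, Rinv_0_lt_compat, Ha]. }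
  replace ((a * x - 1) ^ 2 / a) with (a * x ^ 2 - 2 * x + / a) in H by (field; lra). lra.
Qed.

Lemma exp_m1_bound : 0 <= exp (- 1) < 1.
Proof.
split; [apply Rlt_le, exp_pos|]. rewrite <- exp_0. apply exp_increasing; lra.
Qed.

Lemma gauss_le_geom a n : 0 < a ->
  exp (- (a * IZR n ^ 2)) <= exp (/ a) * exp (- 1) ^ Z.abs_nat n.
Proof.
intros Ha. eapply Rle_trans; [|apply gauss_linear_le_geom, Ha].
assert (H := exp_pos (- (a * IZR n ^ 2))). assert (H' := Rabs_pos (IZR n)). nra.
Qed.

Lemma climc_theta a y : 0 < a -> climc (zpartial (theta_term a y)) (theta a y).
Proof.
intros Ha. apply climc_zsum with (exp (/ a)) (exp (- 1)); [apply exp_m1_bound|].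
intros n. rewrite Cmod_theta_term. apply gauss_le_geom, Ha.
Qed.

Lemma theta_opp a y : theta a (- y) = theta a y.
Proof.
apply zsum_ext; intros K. rewrite <- zpartial_opp.
apply zpartial_ext; intros n _. unfold theta_term.
rewrite opp_IZR. f_equal; [do 2 f_equal; ring|f_equal; ring].
Qed.

Lemma theta_shift a y k : theta a (y - IZR k) = theta a y.
Proof.
apply zsum_ext; intros K. apply zpartial_ext; intros n _. unfold theta_term.
f_equal. apply cis_shift with (- (n * k))%Z.
rewrite opp_IZR, mult_IZR. ring.
Qed.

Lemma climc_cis u l : is_lim_seq u (Finite l) -> climc (fun n => cis (u n)) (cis l).
Proof.
intros H; split; simpl.
- apply (is_lim_seq_continuous cos u l); [apply continuity_cos|exact H].
- apply (is_lim_seq_continuous sin u l); [apply continuity_sin|exact H].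
Qed.

Lemma is_lim_seq_inv_odd : is_lim_seq (fun h => / INR (2 * h + 1)) 0.
Proof.
apply is_lim_seq_le_le with (fun _ => 0) (fun h => / (INR h + 1)).
- intros h. assert (H := pos_INR h). rewrite plus_INR, mult_INR; simpl (INR 2); simpl (INR 1).
  split; [apply Rlt_le, Rinv_0_lt_compat; lra|apply Rinv_le_contravar; lra].
- apply is_lim_seq_const.
- apply is_lim_seq_ext with (fun n => / INR (S n)); [intros n; rewrite S_INR; reflexivity|].
  apply (is_lim_seq_incr_1 (fun n => / INR n)).
  apply (is_lim_seq_inv _ p_infty); [apply is_lim_seq_INR|discriminate].
Qed.

Lemma is_lim_seq_sin_scaled x :
  is_lim_seq (fun h => INR (2 * h + 1) * sin (x / INR (2 * h + 1))) x.
Proof.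
assert (HL : forall h, 0 < INR (2 * h + 1)) by (intros h; apply lt_0_INR; lia).
(* The limit of sin z / z is punctured at 0, so x = 0 is treated apart. *)
destruct (Req_dec x 0) as [->|Hx].
- apply is_lim_seq_ext with (fun _ => 0); [|apply is_lim_seq_const].
  intros h. unfold Rdiv. rewrite Rmult_0_l, sin_0; ring.
- apply is_lim_seq_ext with (fun h => x * (sin (x / INR (2 * h + 1)) / (x / INR (2 * h + 1)))).
  + intros h. assert (H := HL h). field. split; lra.
  + replace (Finite x) with (Finite (x * 1)) by (f_equal; ring).
    apply is_lim_seq_mult'; [apply is_lim_seq_const|].
    apply (is_lim_comp_seq (fun z => sin z / z) _ 0 1 is_lim_sinc_0).
    * exists 0%nat. intros h _ E. injection E as E.
      assert (H := HL h). apply (Rmult_eq_compat_r (INR (2 * h + 1))) in E.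
      unfold Rdiv in E. rewrite Rmult_assoc, Rinv_l in E; lra.
    * replace (Finite 0) with (Finite (x * 0)) by (f_equal; ring).
      apply is_lim_seq_mult'; [apply is_lim_seq_const|apply is_lim_seq_inv_odd].
Qed.

Lemma pow_exp x n : exp x ^ n = exp (INR n * x).
Proof.
induction n as [|n IH].
- simpl. rewrite Rmult_0_l, exp_0; reflexivity.
- rewrite S_INR. simpl pow. rewrite IH, <- exp_plus. f_equal; ring.
Qed.

(* With [L = 2h+1], these satisfy [polya_s / L -> y] and [polya_m / L^2 -> tau]. *)
Definition polya_s (y : R) (h : nat) : Z := (up (y * INR (2 * h + 1)) - 1)%Z.
Definition polya_m (tau : R) (h : nat) : nat := Z.to_nat (up (tau * INR (2 * h + 1) ^ 2)).

(** Since [up] is strictly above its argument, [polya_s] is a floor: then y <= 1/2 gives 2s <= L, as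
    [polya_bound] requires. By contrast [polya_m] is rounded up, so that m >= tau L^2 in the
    domination estimates. *)
Lemma polya_s_bounds y h : 0 <= y ->
  (0 <= polya_s y h)%Z /\ y * INR (2 * h + 1) - 1 <= IZR (polya_s y h) <= y * INR (2 * h + 1).
Proof.
intros Hy. unfold polya_s.
assert (HL := pos_INR (2 * h + 1)).
destruct (archimed (y * INR (2 * h + 1))) as [H1 H2].
rewrite minus_IZR. split; [|lra].
assert (0 < up (y * INR (2 * h + 1)))%Z; [|lia].
apply lt_IZR. nra.
Qed.

Lemma polya_m_bounds tau h : 0 < tau -> (0 < polya_m tau h)%nat /\
  tau * INR (2 * h + 1) ^ 2 <= INR (polya_m tau h) <= tau * INR (2 * h + 1) ^ 2 + 1.
Proof.
intros Ht. unfold polya_m.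
assert (HL : 0 < INR (2 * h + 1)) by (apply lt_0_INR; lia).
destruct (archimed (tau * INR (2 * h + 1) ^ 2)) as [H1 H2].
assert (0 < tau * INR (2 * h + 1) ^ 2) by (apply Rmult_lt_0_compat; [lra|apply pow_lt, HL]).
assert (0 < up (tau * INR (2 * h + 1) ^ 2))%Z by (apply lt_IZR; lra).
split; [lia|]. rewrite (INR_IZR_INZ (Z.to_nat _)), Z2Nat.id by lia. lra.
Qed.

Lemma lim_polya_s y : 0 <= y -> is_lim_seq (fun h => IZR (polya_s y h) / INR (2 * h + 1)) y.
Proof.
intros Hy.
apply is_lim_seq_le_le with (fun h => y - / INR (2 * h + 1)) (fun _ => y).
- intros h. assert (HL : 0 < INR (2 * h + 1)) by (apply lt_0_INR; lia).
  destruct (polya_s_bounds y h Hy) as [_ [H1 H2]].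
  split; apply Rmult_le_reg_r with (INR (2 * h + 1)); try lra.
  + unfold Rdiv. rewrite (Rmult_assoc (IZR _)), Rinv_l, Rmult_minus_distr_r, Rinv_l; lra.
  + unfold Rdiv. rewrite (Rmult_assoc (IZR _)), Rinv_l; lra.
- replace (Finite y) with (Finite (y - 0)) by (f_equal; ring).
  apply is_lim_seq_minus'; [apply is_lim_seq_const|apply is_lim_seq_inv_odd].
- apply is_lim_seq_const.
Qed.

Lemma lim_polya_m tau : 0 < tau ->
  is_lim_seq (fun h => INR (polya_m tau h) / INR (2 * h + 1) ^ 2) tau.
Proof.
intros Ht.
apply is_lim_seq_le_le with (fun _ => tau) (fun h => tau + / INR (2 * h + 1) * / INR (2 * h + 1)).
- intros h. assert (HL : 0 < INR (2 * h + 1)) by (apply lt_0_INR; lia).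
  destruct (polya_m_bounds tau h Ht) as [_ [H1 H2]].
  set (L := INR (2 * h + 1)) in *. set (m := INR (polya_m tau h)) in *.
  assert (HL2 : 0 < L ^ 2) by (apply pow_lt, HL).
  split; apply Rmult_le_reg_r with (L ^ 2); try exact HL2.
  + replace (m / L ^ 2 * L ^ 2) with m by (field; lra). lra.
  + replace (m / L ^ 2 * L ^ 2) with m by (field; lra).
    replace ((tau + / L * / L) * L ^ 2) with (tau * L ^ 2 + 1) by (field; lra). lra.
- apply is_lim_seq_const.
- replace (Finite tau) with (Finite (tau + 0 * 0)) by (f_equal; ring).
  apply is_lim_seq_plus'; [apply is_lim_seq_const|].
  apply is_lim_seq_mult'; apply is_lim_seq_inv_odd.
Qed.

Lemma lim_polya_psi tau y : 0 < tau -> 0 <= y ->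
  is_lim_seq (fun h => psi (INR (polya_m tau h)) (IZR (polya_s y h))) (y ^ 2 / tau).
Proof.
intros Ht Hy.
(* Numerator and denominator of [psi] are divided by L^2; the linear term s of the denominator then
   vanishes in the limit. *)
apply is_lim_seq_ext with (fun h =>
  (IZR (polya_s y h) / INR (2 * h + 1)) * (IZR (polya_s y h) / INR (2 * h + 1)) /
  (INR (polya_m tau h) / INR (2 * h + 1) ^ 2 + IZR (polya_s y h) / INR (2 * h + 1) * / INR (2 * h + 1))).
- intros h. assert (HL : 0 < INR (2 * h + 1)) by (apply lt_0_INR; lia).
  destruct (polya_m_bounds tau h Ht) as [Hm _]. apply lt_0_INR in Hm.
  destruct (polya_s_bounds y h Hy) as [Hs _]. apply IZR_le in Hs.
  unfold psi. field. split; lra.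
- replace (Finite (y ^ 2 / tau)) with (Finite (y * y / (tau + y * 0))) by (f_equal; field; lra).
  apply is_lim_seq_div'; [| |lra].
  + apply is_lim_seq_mult'; apply lim_polya_s, Hy.
  + apply is_lim_seq_plus'; [apply lim_polya_m, Ht|].
    apply is_lim_seq_mult'; [apply lim_polya_s, Hy|apply is_lim_seq_inv_odd].
Qed.

(** This is 1 + x <= e^x at x = u/(1-u), inverted; it complements 1 - u <= e^{-u} from below. *)
Lemma exp_le_1_minus u : u < 1 -> exp (- (u / (1 - u))) <= 1 - u.
Proof.
intros Hu. rewrite exp_Ropp.
rewrite <- (Rinv_inv (1 - u)). apply Rinv_le_contravar.
- apply Rinv_0_lt_compat; lra.
- eapply Rle_trans; [|apply exp_ineq1_le]. right. field. lra.
Qed.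

(** Writing cos^2 = 1 - u with u = sin^2, the power (1-u)^m is squeezed between exp(-mu/(1-u)) and
    exp(-mu), without logarithms; mu tends to pi^2 tau j^2. *)
Lemma lim_cos_power tau j : 0 < tau ->
  is_lim_seq (fun h => cos (PI * IZR j / INR (2 * h + 1)) ^ (2 * polya_m tau h))
    (exp (- (PI ^ 2 * tau * IZR j ^ 2))).
Proof.
intros Ht.
set (u := fun h => sin (PI * IZR j / INR (2 * h + 1)) ^ 2).
set (v := fun h => INR (polya_m tau h) * u h).
assert (Hcos : forall h, cos (PI * IZR j / INR (2 * h + 1)) ^ (2 * polya_m tau h)
   = (1 - u h) ^ polya_m tau h).
{ intros h. rewrite pow_mult. f_equal. unfold u.
  assert (H := sin2_cos2 (PI * IZR j / INR (2 * h + 1))). rewrite !Rsqr_pow2 in H. lra. }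
assert (HL : forall h, 0 < INR (2 * h + 1)) by (intros h; apply lt_0_INR; lia).
assert (Hs := is_lim_seq_sin_scaled (PI * IZR j)).
assert (Hv : is_lim_seq v (PI ^ 2 * tau * IZR j ^ 2)).
{ apply is_lim_seq_ext with (fun h => INR (polya_m tau h) / INR (2 * h + 1) ^ 2 *
   ((INR (2 * h + 1) * sin (PI * IZR j / INR (2 * h + 1))) * (INR (2 * h + 1) * sin (PI * IZR j / INR (2 * h + 1))))).
  - intros h. unfold v, u. assert (H := HL h). field. lra.
  - replace (PI ^ 2 * tau * IZR j ^ 2) with (tau * (PI * IZR j * (PI * IZR j))) by ring.
    apply is_lim_seq_mult'; [apply lim_polya_m, Ht|]. apply is_lim_seq_mult'; exact Hs. }
assert (Hu : is_lim_seq u 0).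
{ apply is_lim_seq_ext with (fun h =>
   ((INR (2 * h + 1) * sin (PI * IZR j / INR (2 * h + 1))) * (INR (2 * h + 1) * sin (PI * IZR j / INR (2 * h + 1))))
   * (/ INR (2 * h + 1) * / INR (2 * h + 1))).
  - intros h. unfold u. assert (H := HL h). field. lra.
  - replace (Finite 0) with (Finite (PI * IZR j * (PI * IZR j) * (0 * 0))) by (f_equal; ring).
    apply is_lim_seq_mult'; apply is_lim_seq_mult'; try exact Hs; apply is_lim_seq_inv_odd. }
assert (Hexp : forall w l, is_lim_seq w (Finite l) -> is_lim_seq (fun h => exp (- w h)) (exp (- l))).
{ intros w l Hw. apply (is_lim_seq_continuous exp (fun h => - w h) (- l)).
  - apply derivable_continuous, derivable_exp.
  - apply (is_lim_seq_opp w l); exact Hw. }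
apply is_lim_seq_le_le_loc with (fun h => exp (- (v h / (1 - u h)))) (fun h => exp (- v h)).
- assert (Hlt : eventually (fun h => u h < 1)).
  { apply is_lim_seq_spec in Hu. destruct (Hu (mkposreal 1 Rlt_0_1)) as [h0 H0].
    exists h0; intros h Hh. specialize (H0 h Hh). simpl in H0. apply Rabs_def2 in H0. lra. }
  destruct Hlt as [h0 H0]. exists h0; intros h Hh. specialize (H0 h Hh).
  rewrite Hcos. split.
  + replace (- (v h / (1 - u h))) with (INR (polya_m tau h) * (- (u h / (1 - u h))))
      by (unfold v; field; lra).
    rewrite <- pow_exp. apply pow_incr. split; [apply Rlt_le, exp_pos|apply exp_le_1_minus, H0].
  + replace (- v h) with (INR (polya_m tau h) * - u h) by (unfold v; ring).
    rewrite <- pow_exp. apply pow_incr. split; [lra|].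
    eapply Rle_trans; [|apply exp_ineq1_le]. lra.
- apply Hexp.
  replace (PI ^ 2 * tau * IZR j ^ 2) with (PI ^ 2 * tau * IZR j ^ 2 / (1 - 0)) by field.
  apply is_lim_seq_div'; [exact Hv| |lra].
  apply is_lim_seq_minus'; [apply is_lim_seq_const|exact Hu].
- apply Hexp, Hv.
Qed.

(** A majorant independent of h: cos^2 <= exp(-sin^2), and |sin(pi j/L)| >= |j|/L since |j| <= h <
    L/2. The exponent is smaller than the limiting one by a factor pi^2, which is harmless for
    summability. *)
Lemma Cmod_polya_term_le tau s h j : 0 < tau -> (Z.abs j <= Z.of_nat h)%Z ->
  Cmod (polya_term h (polya_m tau h) s j) <= exp (- (tau * IZR j ^ 2)).
Proof.
intros Ht Hj.
assert (HL : 0 < INR (2 * h + 1)) by (apply lt_0_INR; lia).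
destruct (polya_m_bounds tau h Ht) as [_ [Hm _]].
unfold polya_term. rewrite Cmod_mult, Cmod_cis, Cmod_R, Rmult_1_r.
set (L := INR (2 * h + 1)) in *.
assert (Hy : Rabs (IZR j / L) <= / 2).
{ unfold Rdiv. rewrite Rabs_mult, (Rabs_pos_eq (/ L)) by (apply Rlt_le, Rinv_0_lt_compat, HL).
  apply Rmult_le_reg_r with L; [exact HL|]. rewrite Rmult_assoc, Rinv_l by lra.
  rewrite <- abs_IZR. apply IZR_le in Hj. rewrite <- INR_IZR_INZ in Hj.
  unfold L. rewrite plus_INR, mult_INR. simpl (INR 2); simpl (INR 1). lra. }
assert (Hsin := Rabs_sin_PI_ge _ Hy).
replace (PI * (IZR j / L)) with (PI * IZR j / L) in Hsin by (field; lra).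
set (x := PI * IZR j / L) in *.
rewrite pow_mult.
assert (Hc : cos x ^ 2 <= exp (- (IZR j / L) ^ 2)).
{ eapply Rle_trans; [|apply exp_ineq1_le].
  assert (H := sin2_cos2 x). rewrite !Rsqr_pow2 in H.
  assert ((IZR j / L) ^ 2 <= sin x ^ 2) by (rewrite <- (pow2_abs (IZR j / L)), <- (pow2_abs (sin x)); apply pow_incr; split; [apply Rabs_pos|exact Hsin]).
  lra. }
rewrite Rabs_pos_eq by (apply pow_le; nra).
apply Rle_trans with (exp (- (IZR j / L) ^ 2) ^ polya_m tau h).
- apply pow_incr. split; [nra|exact Hc].
- rewrite pow_exp. apply exp_le.
  assert (tau * L ^ 2 * (IZR j / L) ^ 2 <= INR (polya_m tau h) * (IZR j / L) ^ 2)
    by (apply Rmult_le_compat_r; [nra|exact Hm]).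
  replace (tau * L ^ 2 * (IZR j / L) ^ 2) with (tau * IZR j ^ 2) in H by (field; lra). lra.
Qed.

(** The factor from the remote indices in [polya_bound], made uniform in h: m <= tau L^2 + 1 and L
    >= 1 give 2 psi(L/2) >= 1/(2(tau+2)). *)
Definition theta_const (tau : R) : R := 1 + 2 / (1 - exp (- / (2 * (tau + 2)))).

Lemma polya_bound_uniform tau y h : 0 < tau -> 0 <= y <= / 2 ->
  Cmod (zpartial (polya_term h (polya_m tau h) (polya_s y h)) h) <=
  sqrt (/ (2 * tau)) * exp (- psi (INR (polya_m tau h)) (IZR (polya_s y h))) * theta_const tau.
Proof.
intros Ht Hy.
assert (HL : 1 <= INR (2 * h + 1)) by (apply (le_INR 1); lia).
destruct (polya_m_bounds tau h Ht) as [Hm0 [Hm1 Hm2]].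
destruct (polya_s_bounds y h ltac:(lra)) as [Hs0 [Hs1 Hs2]].
eapply Rle_trans; [apply polya_bound; [exact Hm0|exact Hs0|]|].
{ nra. }
set (L := INR (2 * h + 1)) in *. set (m := polya_m tau h) in *.
assert (Hm' : 0 < INR m) by (apply lt_0_INR, Hm0).
set (x := bin (2 * m) m / 4 ^ m).
assert (Hx0 : 0 <= x).
{ apply Rmult_le_pos; [apply bin_pos|]. apply Rlt_le, Rinv_0_lt_compat, pow_lt; lra. }
assert (Hx : L * x <= sqrt (/ (2 * tau))).
{ rewrite <- (sqrt_pow2 (L * x)) by (apply Rmult_le_pos; lra). apply sqrt_le_1_alt.
  assert (H := bin_central m). fold x in H.
  apply Rmult_le_reg_r with (2 * tau); [lra|]. rewrite Rinv_l by lra.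
  assert (0 <= x ^ 2) by nra. nra. }
assert (Hpsi : / (2 * (tau + 2)) <= 2 * psi (INR m) (L / 2)).
{ unfold psi.
  replace (2 * ((L / 2) ^ 2 / (INR m + L / 2))) with (L ^ 2 / (2 * (INR m + L / 2))) by (field; lra).
  apply Rmult_le_reg_r with (2 * (INR m + L / 2)); [lra|].
  replace (L ^ 2 / (2 * (INR m + L / 2)) * (2 * (INR m + L / 2))) with (L ^ 2) by (field; lra).
  apply Rmult_le_reg_l with (2 * (tau + 2)); [lra|].
  rewrite <- Rmult_assoc, Rinv_r by lra. nra. }
set (E := exp (- psi (INR m) (IZR (polya_s y h)))).
assert (HE : 0 < E) by apply exp_pos.
assert (Hp0 : 0 < / (2 * (tau + 2))) by (apply Rinv_0_lt_compat; lra).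
assert (Hq1 : exp (- / (2 * (tau + 2))) < 1).
{ rewrite <- exp_0. apply exp_increasing; lra. }
assert (Hq2 : exp (- (2 * psi (INR m) (L / 2))) <= exp (- / (2 * (tau + 2)))) by (apply exp_le; lra).
apply Rmult_le_compat.
- apply Rmult_le_pos; [|lra]. apply Rmult_le_pos; lra.
- assert (0 < 2 / (1 - exp (- (2 * psi (INR m) (L / 2))))) by (apply Rdiv_lt_0_compat; lra). lra.
- apply Rmult_le_compat_r; lra.
- unfold theta_const. apply Rplus_le_compat_l, Rmult_le_compat_l; [lra|].
  apply Rinv_le_contravar; lra.
Qed.

(* Tannery's argument: at fixed [K] let [h] tend to infinity in the partial sums of the
   cosine powers, whose tails are dominated uniformly in [h], then let [K] tend to infinity. *)
Lemma theta_bound_pos tau y : 0 < tau -> 0 <= y <= / 2 ->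
  Cmod (theta (PI ^ 2 * tau) y) <= sqrt (/ (2 * tau)) * exp (- (y ^ 2 / tau)) * theta_const tau.
Proof.
intros Ht Hy.
assert (HP := PI_RGT_0).
set (q := exp (- 1)). assert (Hq : 0 <= q < 1) by apply exp_m1_bound.
set (B := sqrt (/ (2 * tau)) * exp (- (y ^ 2 / tau)) * theta_const tau).
set (D := 2 * exp (/ tau) * (q / (1 - q))).
assert (HD : 0 <= D).
{ unfold D. apply Rmult_le_pos; [assert (H := exp_pos (/ tau)); lra|].
  apply Rmult_le_pos; [lra|]. apply Rlt_le, Rinv_0_lt_compat; lra. }
assert (HK : forall K, Cmod (zpartial (theta_term (PI ^ 2 * tau) y) K) <= B + D * q ^ K).
{ intros K.
  apply climc_Cmod_le with
    (u := fun h => zpartial (polya_term h (polya_m tau h) (polya_s y h)) K)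
    (v := fun h => sqrt (/ (2 * tau)) * exp (- psi (INR (polya_m tau h)) (IZR (polya_s y h)))
                   * theta_const tau + D * q ^ K).
  - unfold zpartial.
    apply (climc_csum _ (fun i h => polya_term h (polya_m tau h) (polya_s y h) (Z.of_nat i - Z.of_nat K)%Z)).
    intros i _. set (j := (Z.of_nat i - Z.of_nat K)%Z).
    apply climc_mult.
    + apply climc_RtoC, lim_cos_power, Ht.
    + apply climc_cis. apply is_lim_seq_mult'; [apply is_lim_seq_const|apply lim_polya_s; lra].
  - apply is_lim_seq_plus'; [|apply is_lim_seq_const].
    apply is_lim_seq_mult'; [|apply is_lim_seq_const].
    apply is_lim_seq_mult'; [apply is_lim_seq_const|].
    apply (is_lim_seq_continuous exp (fun h => - psi (INR (polya_m tau h)) (IZR (polya_s y h)))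
             (- (y ^ 2 / tau))).
    + apply derivable_continuous, derivable_exp.
    + apply (is_lim_seq_opp _ (y ^ 2 / tau)), lim_polya_psi; lra.
  - exists K. intros h Hh.
    set (p := polya_term h (polya_m tau h) (polya_s y h)).
    replace (zpartial p K) with (Cminus (zpartial p h) (Cminus (zpartial p h) (zpartial p K))) by ring.
    eapply Rle_trans; [apply Cmod_triangle|]. rewrite Cmod_opp.
    apply Rplus_le_compat; [apply polya_bound_uniform; lra|].
    eapply Rle_trans; [apply zpartial_diff_le, Hh|].
    eapply Rle_trans; [apply (rzpartial_geom_tail _ (exp (/ tau)) q K h Hh Hq)|].
    + intros n Hn. eapply Rle_trans; [apply Cmod_polya_term_le; [exact Ht|lia]|].
      apply gauss_le_geom, Ht.
    + fold D. assert (0 <= q ^ h) by (apply pow_le; lra). nra. }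
apply climc_Cmod_le with (u := zpartial (theta_term (PI ^ 2 * tau) y)) (v := fun K => B + D * q ^ K).
- apply climc_theta, Rmult_lt_0_compat; [apply pow_lt, HP|exact Ht].
- replace (Finite B) with (Finite (B + D * 0)) by (f_equal; ring).
  apply is_lim_seq_plus'; [apply is_lim_seq_const|].
  apply is_lim_seq_mult'; [apply is_lim_seq_const|].
  apply is_lim_seq_geom. rewrite Rabs_pos_eq; lra.
- exists 0%nat; intros K _; apply HK.
Qed.

Lemma theta_bound tau y : 0 < tau -> Rabs y <= / 2 ->
  Cmod (theta (PI ^ 2 * tau) y) <= sqrt (/ (2 * tau)) * exp (- (y ^ 2 / tau)) * theta_const tau.
Proof.
intros Ht Hy. destruct (Rle_dec 0 y) as [H|H].
- rewrite Rabs_pos_eq in Hy by lra. apply theta_bound_pos; lra.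
- rewrite Rabs_left in Hy by lra. rewrite <- theta_opp.
  replace (y ^ 2) with ((- y) ^ 2) by ring. apply theta_bound_pos; lra.
Qed.

(** * Pointwise error bounds *)

(** [csigma] inverts only the real part of the series. At 0 the sum is real and at least its term 1
    at n = 0, so [csigma] does normalize, and it is at most 1. *)
Lemma theta_0 a : 0 < a ->
  theta a 0 = RtoC (fst (theta a 0)) /\ 1 <= fst (theta a 0).
Proof.
intros Ha.
set (g := fun n : Z => exp (- (a * IZR n ^ 2))).
assert (Hz : forall K, zpartial (theta_term a 0) K = RtoC (rzpartial g K)).
{ intros K. rewrite <- zpartial_RtoC. apply zpartial_ext; intros n _.
  unfold theta_term. rewrite Rmult_0_r, cis_0. unfold g. ring. }
destruct (climc_theta a 0 Ha) as [H1 H2]. split.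
- rewrite (surjective_pairing (theta a 0)) at 1. unfold RtoC. f_equal.
  apply is_lim_seq_unique in H2.
  rewrite (Lim_seq_ext _ (fun _ => 0)), Lim_seq_const in H2.
  + injection H2; auto.
  + intros K; rewrite Hz; reflexivity.
- apply (is_lim_seq_le (fun _ => 1) _ 1 (fst (theta a 0)) ) with (2 := is_lim_seq_const 1) (3 := H1).
  intros K. rewrite Hz; simpl fst. induction K as [|K IH].
  + rewrite rzpartial_0. unfold g. simpl. rewrite Rmult_0_l, Rmult_0_r, Ropp_0, exp_0; lra.
  + rewrite rzpartial_S.
    assert (0 < g (Z.of_nat (S K))) by apply exp_pos.
    assert (0 < g (- Z.of_nat (S K))%Z) by apply exp_pos. lra.
Qed.

Definition node (N j : nat) : R := INR j / (2 * INR N).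

(** From (|n|-d)^2 >= 0 the Gaussian lies below e^{ad^2} q^{|n|} with q = e^{-2ad}. The geometric
    tail contributes q/(1-q) = 1/(e^{2ad}-1) <= 1/(2ad). *)
Lemma gauss_tail a (d : nat) K : 0 < a -> (0 < d)%nat ->
  rzpartial (fun n => if Z_le_dec (Z.abs n) (Z.of_nat d) then 0 else 2 * exp (- (a * IZR n ^ 2))) K
  <= 4 * exp (- (a * INR d ^ 2)) / (2 * a * INR d).
Proof.
intros Ha Hd. assert (Hd' : 0 < INR d) by (apply lt_0_INR, Hd).
set (w := fun n : Z => _).
assert (Had : 0 < a * INR d) by (apply Rmult_lt_0_compat; assumption).
assert (Hw0 : forall K, (K <= d)%nat -> rzpartial w K = 0).
{ clear K. induction K as [|K IH]; intros HK.
  - rewrite rzpartial_0. unfold w. destruct (Z_le_dec _ _); [reflexivity|lia].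
  - rewrite rzpartial_S, IH by lia. unfold w. cbv beta. rewrite Z.abs_opp. destruct (Z_le_dec _ _); [ring|lia]. }
assert (HE := exp_pos (- (a * INR d ^ 2))).
destruct (le_ge_dec K d) as [HK|HK].
{ rewrite Hw0 by lia. apply Rlt_le, Rdiv_lt_0_compat; lra. }
set (q := exp (- (2 * (a * INR d)))).
assert (Hq0 : 0 < q) by apply exp_pos.
assert (Hq1 : q < 1) by (unfold q; rewrite <- exp_0; apply exp_increasing; lra).
assert (Hqd : q ^ d = exp (- (2 * (a * INR d ^ 2)))).
{ unfold q. rewrite pow_exp. f_equal. ring. }
assert (H := rzpartial_geom_tail w (2 * exp (a * INR d ^ 2)) q d K HK ltac:(lra)).
rewrite (Hw0 d) in H by lia.
apply Rle_trans with (4 * exp (- (a * INR d ^ 2)) * (q / (1 - q))).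
- apply Rle_trans with (2 * (2 * exp (a * INR d ^ 2)) * (q / (1 - q)) * q ^ d).
  + eapply Rle_trans; [|eapply Rle_trans; [apply H|]]; [lra| |].
    * intros n Hn. unfold w. destruct (Z_le_dec _ _); [lia|].
      rewrite Rmult_assoc. apply Rmult_le_compat_l; [lra|].
      unfold q. rewrite pow_exp, <- exp_plus. apply exp_le.
      assert (Hx : INR (Z.abs_nat n) = Rabs (IZR n)).
      { rewrite <- abs_IZR, INR_IZR_INZ. f_equal. lia. }
      rewrite Hx, <- (pow2_abs (IZR n)).
      assert (0 <= a * (Rabs (IZR n) - INR d) ^ 2)
        by (apply Rmult_le_pos; [lra|apply pow2_ge_0]).
      replace (a * INR d ^ 2 + Rabs (IZR n) * - (2 * (a * INR d)))
        with (a * (Rabs (IZR n) - INR d) ^ 2 - a * Rabs (IZR n) ^ 2) by ring. lra.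
    * apply Rmult_le_compat_l.
      { assert (0 < exp (a * INR d ^ 2)) by apply exp_pos.
        apply Rmult_le_pos; [lra|]. apply Rlt_le, Rdiv_lt_0_compat; lra. }
      assert (0 <= q ^ K) by (apply pow_le; lra). lra.
  + rewrite Hqd. right.
    replace (- (a * INR d ^ 2)) with (a * INR d ^ 2 + - (2 * (a * INR d ^ 2))) by ring.
    rewrite exp_plus. ring.
- unfold Rdiv at 2. apply Rmult_le_compat_l; [lra|].
  apply Rle_div_l; [lra|].
  replace (/ (2 * a * INR d) * (1 - q)) with ((1 - q) / (2 * (a * INR d))) by (field; lra).
  apply Rmult_le_reg_r with (2 * (a * INR d)); [lra|].
  replace ((1 - q) / (2 * (a * INR d)) * (2 * (a * INR d))) with (1 - q) by (field; lra).
  assert (Hz := exp_ineq1_le (2 * (a * INR d))).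
  assert (Hqq : q * exp (2 * (a * INR d)) = 1).
  { unfold q. rewrite <- exp_plus, Rplus_opp_l. apply exp_0. }
  nra.
Qed.

Lemma exponential_error (N M : nat) (a : R) (k : Z) (x : R) : 0 < a -> (M < N)%nat ->
  (- Z.of_nat M <= k < Z.of_nat M)%Z ->
  Cmod (Cminus (Cmult (theta a 0) (cis (2 * PI * IZR k * x)))
    (csum (2 * N) (fun j => Cmult (cis (2 * PI * IZR k * node N j))
       (Cmult (sN N (x - node N j)) (theta a (x - node N j))))))
  <= 4 * exp (- (a * INR (N - M) ^ 2)) / (2 * a * INR (N - M)).
Proof.
intros Ha HMN Hk.
set (B := 4 * _ / _).
(* The theta series is cut at K, where exchanging the sums over frequencies and nodes is finite; the
   bound does not depend on K and passes to the limit. *)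
apply climc_Cmod_le with (v := fun _ => B) (u := fun K =>
  Cminus (Cmult (zpartial (theta_term a 0) K) (cis (2 * PI * IZR k * x)))
    (csum (2 * N) (fun j => Cmult (cis (2 * PI * IZR k * node N j))
       (Cmult (sN N (x - node N j)) (zpartial (theta_term a (x - node N j)) K))))).
- apply climc_minus.
  + apply climc_mult; [apply climc_theta, Ha|apply climc_const].
  + apply climc_csum with (u := fun j K => Cmult (cis (2 * PI * IZR k * node N j))
       (Cmult (sN N (x - node N j)) (zpartial (theta_term a (x - node N j)) K))).
    intros j _. apply climc_mult; [apply climc_const|].
    apply climc_mult; [apply climc_const|apply climc_theta, Ha].
- apply is_lim_seq_const.
- exists 0%nat; intros K _.
  set (g := fun n : Z => exp (- (a * IZR n ^ 2))).
  assert (E : Cminus (Cmult (zpartial (theta_term a 0) K) (cis (2 * PI * IZR k * x)))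
    (csum (2 * N) (fun j => Cmult (cis (2 * PI * IZR k * node N j))
       (Cmult (sN N (x - node N j)) (zpartial (theta_term a (x - node N j)) K))))
    = zpartial (fun n => Cmult (RtoC (g n)) (Cminus (cis (2 * PI * IZR k * x))
        (cis (2 * PI * IZR (n + reduce N (k - n)) * x)))) K).
  { unfold zpartial. rewrite (Cmult_comm (csum _ _)), <- csum_scal.
    rewrite (csum_ext (2 * N) _ (fun j => csum (2 * K + 1) (fun i =>
       Cmult (Cmult (cis (2 * PI * IZR k * node N j)) (sN N (x - node N j)))
         (theta_term a (x - node N j) (Z.of_nat i - Z.of_nat K)%Z))))
      by (intros j _; rewrite csum_scal; ring).
    rewrite csum_swap, <- csum_minus. apply csum_ext; intros i _.
    set (n := (Z.of_nat i - Z.of_nat K)%Z).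
    (* The phase n(x - x_j) + k x_j is regrouped as n x + (k-n) x_j: the nodes only see the
       frequency k - n. *)
    rewrite (csum_ext _ _ (fun j => Cmult (Cmult (RtoC (g n)) (cis (2 * PI * IZR n * x)))
      (Cmult (cis (2 * PI * IZR (k - n) * (INR j / (2 * INR N)))) (sN N (x - INR j / (2 * INR N)))))).
    - rewrite csum_scal, sN_interpolation by lia.
      replace (2 * PI * IZR (n + reduce N (k - n)) * x)
        with (2 * PI * IZR n * x + 2 * PI * IZR (reduce N (k - n)) * x) by (rewrite plus_IZR; ring).
      rewrite cis_plus. unfold theta_term. rewrite Rmult_0_r, cis_0. fold (g n). ring.
    - intros j _. unfold theta_term, node. fold (g n). set (xj := INR j / (2 * INR N)).
      transitivity (Cmult (Cmult (RtoC (g n)) (sN N (x - xj)))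
        (Cmult (cis (2 * PI * IZR n * x)) (cis (2 * PI * IZR (k - n) * xj)))); [|ring].
      transitivity (Cmult (Cmult (RtoC (g n)) (sN N (x - xj)))
        (Cmult (cis (2 * PI * IZR k * xj)) (cis (2 * PI * IZR n * (x - xj))))); [ring|].
      rewrite <- !cis_plus, minus_IZR. do 2 f_equal. ring. }
  rewrite E. eapply Rle_trans; [apply Cmod_zpartial_le|].
  eapply Rle_trans; [|apply (gauss_tail a (N - M) K Ha ltac:(lia))].
  apply rzpartial_le; intros n _. rewrite Cmod_mult, Cmod_R, Rabs_pos_eq by apply Rlt_le, exp_pos.
  cbv beta. destruct (Z_le_dec _ _) as [Hn|Hn].
  (* The half-open ranges fit exactly: -M <= k <= M-1 and |n| <= N-M give -N <= k-n <= N-1. *)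
  + rewrite reduce_id by lia. replace (n + (k - n))%Z with k by lia.
    replace (Cminus _ _) with (RtoC 0) by ring. rewrite Cmod_0. lra.
  + rewrite Rmult_comm. apply Rmult_le_compat_r; [apply Rlt_le, exp_pos|].
    eapply Rle_trans; [apply Cmod_triangle|]. rewrite Cmod_opp, !Cmod_cis. lra.
Qed.

Definition coef_sum (M : nat) (c : Z -> nat -> C) (i : nat) : R :=
  rsum (2 * M) (fun l => Cmod (c (Z.of_nat l - Z.of_nat M)%Z i)).

Lemma coef_sum_pos M c i : 0 <= coef_sum M c i.
Proof. apply rsum_pos; intros; apply Cmod_ge_0. Qed.

Lemma Cmod_bandlim_le M c x i : Cmod (bandlim M c x i) <= coef_sum M c i.
Proof.
eapply Rle_trans; [apply Cmod_csum_le|]. apply rsum_le; intros l _.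
cbv zeta. rewrite Cmod_mult, Cmod_cis. lra.
Qed.

Lemma gauss_series_theta sigma x : 0 < sigma ->
  gauss_series sigma x = theta (/ (2 * sigma ^ 2)) x.
Proof.
intros Hs. apply zsum_ext; intros K. apply zpartial_ext; intros n _.
unfold theta_term. do 3 f_equal. field. lra.
Qed.

Lemma untruncated_error (N M : nat) (c : Z -> nat -> C) (sigma x : R) (i : nat) :
  0 < sigma -> (M < N)%nat -> let a := / (2 * sigma ^ 2) in
  Cmod (Cminus (bandlim M c x i) (csum (2 * N) (fun j => Cmult (bandlim M c (node N j) i)
     (Cmult (sN N (x - node N j)) (Gsigma sigma (x - node N j))))))
  <= coef_sum M c i * (4 * exp (- (a * INR (N - M) ^ 2)) / (2 * a * INR (N - M))).
Proof.
intros Hs HMN a. set (B := 4 * _ / _).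
assert (Ha : 0 < a) by (apply Rinv_0_lt_compat; assert (0 < sigma ^ 2) by (apply pow_lt, Hs); lra).
destruct (theta_0 a Ha) as [HS0 HS1].
set (S := fst (theta a 0)) in *.
assert (HcS : csigma sigma = / S) by (unfold csigma; rewrite gauss_series_theta by exact Hs; reflexivity).
set (cf := fun l : nat => c (Z.of_nat l - Z.of_nat M)%Z i).
set (e := fun (l : nat) (y : R) => cis (2 * PI * IZR (Z.of_nat l - Z.of_nat M) * y)).
(* Inserting S/S in f puts 1/S in front of the whole error, which is then a linear combination of
   the errors of single exponentials. *)
assert (E : Cminus (bandlim M c x i) (csum (2 * N) (fun j => Cmult (bandlim M c (node N j) i)
     (Cmult (sN N (x - node N j)) (Gsigma sigma (x - node N j)))))
  = Cmult (RtoC (/ S)) (csum (2 * M) (fun l => Cmult (cf l)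
      (Cminus (Cmult (theta a 0) (e l x)) (csum (2 * N) (fun j => Cmult (e l (node N j))
       (Cmult (sN N (x - node N j)) (theta a (x - node N j))))))))).
{ assert (E1 : bandlim M c x i = Cmult (RtoC (/ S)) (csum (2 * M) (fun l => Cmult (cf l) (Cmult (theta a 0) (e l x))))).
  { rewrite (csum_ext _ _ (fun l => Cmult (theta a 0) (Cmult (cf l) (e l x)))) by (intros; ring).
    rewrite csum_scal, HS0, Cmult_assoc, <- RtoC_mult, Rinv_l, Cmult_1_l by lra. reflexivity. }
  assert (E2 : csum (2 * N) (fun j => Cmult (bandlim M c (node N j) i)
     (Cmult (sN N (x - node N j)) (Gsigma sigma (x - node N j)))) =
    Cmult (RtoC (/ S)) (csum (2 * M) (fun l => Cmult (cf l) (csum (2 * N) (fun j => Cmult (e l (node N j))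
       (Cmult (sN N (x - node N j)) (theta a (x - node N j)))))))).
  { rewrite (csum_ext (2 * M) _ (fun l => csum (2 * N) (fun j => Cmult (Cmult (sN N (x - node N j)) (theta a (x - node N j)))
      (Cmult (cf l) (e l (node N j)))))) by
      (intros; rewrite <- csum_scal; apply csum_ext; intros; ring).
    rewrite csum_swap, <- csum_scal. apply csum_ext; intros j _.
    rewrite csum_scal. unfold Gsigma. rewrite HcS, gauss_series_theta by exact Hs. fold a.
    change (csum (2 * M) (fun l => Cmult (cf l) (e l (node N j)))) with (bandlim M c (node N j) i). ring. }
  rewrite E1, E2.
  transitivity (Cmult (RtoC (/ S)) (Cminus (csum (2 * M) (fun l => Cmult (cf l) (Cmult (theta a 0) (e l x))))
    (csum (2 * M) (fun l => Cmult (cf l) (csum (2 * N) (fun j => Cmult (e l (node N j))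
       (Cmult (sN N (x - node N j)) (theta a (x - node N j))))))))); [ring|].
  rewrite <- csum_minus. f_equal. apply csum_ext; intros l _. ring. }
rewrite E, Cmod_mult, Cmod_R, Rabs_pos_eq by (apply Rlt_le, Rinv_0_lt_compat; lra).
rewrite <- (Rmult_1_l (coef_sum M c i * B)).
apply Rmult_le_compat; [apply Rlt_le, Rinv_0_lt_compat; lra|apply Cmod_ge_0| |].
- rewrite <- Rinv_1. apply Rinv_le_contravar; lra.
- eapply Rle_trans; [apply Cmod_csum_le|].
  unfold coef_sum. rewrite Rmult_comm, <- rsum_scal. apply rsum_le; intros l Hl.
  rewrite Cmod_mult, Rmult_comm. apply Rmult_le_compat_r; [apply Cmod_ge_0|].
  apply exponential_error; [exact Ha|exact HMN|lia].
Qed.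

Lemma nearest_integer y : exists k : Z, Rabs (y - IZR k) <= / 2.
Proof.
exists (up (y - / 2)). destruct (archimed (y - / 2)). apply Rabs_le. lra.
Qed.

Lemma sN_shift N y k : sN N (y - IZR k) = sN N y.
Proof.
unfold sN. f_equal. apply csum_ext; intros l _.
apply cis_shift with (- ((Z.of_nat l - Z.of_nat N) * k))%Z.
rewrite opp_IZR, mult_IZR. ring.
Qed.

Lemma theta_const_pos tau : 0 < tau -> 0 < theta_const tau.
Proof.
intros H. unfold theta_const.
assert (0 < / (2 * (tau + 2))) by (apply Rinv_0_lt_compat; lra).
assert (exp (- / (2 * (tau + 2))) < 1) by (rewrite <- exp_0; apply exp_increasing; lra).
assert (0 < 2 / (1 - exp (- / (2 * (tau + 2))))) by (apply Rdiv_lt_0_compat; lra). lra.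
Qed.

Lemma theta_const_incr t u : 0 < t -> t <= u -> theta_const t <= theta_const u.
Proof.
intros Ht Htu. unfold theta_const.
assert (0 < / (2 * (u + 2))) by (apply Rinv_0_lt_compat; lra).
assert (/ (2 * (u + 2)) <= / (2 * (t + 2))) by (apply Rinv_le_contravar; lra).
assert (exp (- / (2 * (u + 2))) < 1) by (rewrite <- exp_0; apply exp_increasing; lra).
assert (exp (- / (2 * (t + 2))) <= exp (- / (2 * (u + 2)))) by (apply exp_le; lra).
apply Rplus_le_compat_l, Rmult_le_compat_l; [lra|]. apply Rinv_le_contravar; lra.
Qed.

Lemma truncation_term (N : nat) (tau sigma r y : R) : (0 < N)%nat -> 0 < tau -> 0 < r ->
  0 < sigma -> / (2 * sigma ^ 2) = PI ^ 2 * tau ->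
  Cmod (sN N y) * Cmod (Cminus (Gsigma sigma y) (Grsigma r sigma y)) <=
  / (2 * INR N * r) * (sqrt (/ (2 * tau)) * exp (- (r ^ 2 / tau)) * theta_const tau).
Proof.
intros HN Ht Hr Hs Hst. assert (HN' : 0 < INR N) by (apply lt_0_INR, HN).
assert (HP := PI_RGT_0).
assert (Hc := theta_const_pos tau Ht).
unfold Grsigma. destruct (excluded_middle_informative _) as [_|Hfar].
- replace (Cminus _ _) with (RtoC 0) by ring. rewrite Cmod_0, Rmult_0_r.
  apply Rmult_le_pos; [apply Rlt_le, Rinv_0_lt_compat; nra|].
  apply Rmult_le_pos; [|lra].
  apply Rmult_le_pos; [apply sqrt_pos|apply Rlt_le, exp_pos].
- replace (Cminus _ _) with (Gsigma sigma y) by ring.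
  (* By periodicity both factors may be evaluated at y - k, which lies in [-1/2,1/2] and, outside
     the window, has modulus larger than r. *)
  destruct (nearest_integer y) as [k Hk].
  assert (Hyr : r < Rabs (y - IZR k)).
  { apply Rnot_le_lt. intros H. apply Hfar. exists k; exact H. }
  apply Rmult_le_compat; try apply Cmod_ge_0.
  + rewrite <- (sN_shift N y k).
    eapply Rle_trans; [apply Cmod_sN_le; [exact HN|lra]|].
    apply Rinv_le_contravar; nra.
  + unfold Gsigma, csigma. rewrite !gauss_series_theta by exact Hs.
    assert (Ha : 0 < / (2 * sigma ^ 2)).
    { rewrite Hst. apply Rmult_lt_0_compat; [apply pow_lt, HP|exact Ht]. }
    destruct (theta_0 _ Ha) as [_ H1]. rewrite Hst in *.
    rewrite Cmod_mult, Cmod_R, Rabs_pos_eq by (apply Rlt_le, Rinv_0_lt_compat; lra).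
    rewrite <- (Rmult_1_l (sqrt _ * _ * _)).
    apply Rmult_le_compat; [apply Rlt_le, Rinv_0_lt_compat; lra|apply Cmod_ge_0| |].
    * rewrite <- Rinv_1. apply Rinv_le_contravar; lra.
    * rewrite <- (theta_shift _ y k).
      eapply Rle_trans; [apply theta_bound; [exact Ht|exact Hk]|].
      apply Rmult_le_compat_r; [lra|]. apply Rmult_le_compat_l; [apply sqrt_pos|].
      apply exp_le, Ropp_le_contravar, Rmult_le_compat_r; [apply Rlt_le, Rinv_0_lt_compat, Ht|].
      rewrite <- (pow2_abs (y - IZR k)). apply pow_incr. lra.
Qed.

Lemma truncation_error (N M : nat) (c : Z -> nat -> C) (tau sigma r x : R) (i : nat) :
  (0 < N)%nat -> 0 < tau -> 0 < r -> 0 < sigma -> / (2 * sigma ^ 2) = PI ^ 2 * tau ->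
  Cmod (Cminus (csum (2 * N) (fun j => Cmult (bandlim M c (node N j) i)
     (Cmult (sN N (x - node N j)) (Gsigma sigma (x - node N j)))))
     (recon N r sigma (bandlim M c) x i)) <=
  coef_sum M c i * (/ r * (sqrt (/ (2 * tau)) * exp (- (r ^ 2 / tau)) * theta_const tau)).
Proof.
intros HN Ht Hr Hs Hst. assert (HN' : 0 < INR N) by (apply lt_0_INR, HN).
set (T := sqrt _ * _ * _).
unfold recon. cbv zeta. rewrite <- csum_minus.
eapply Rle_trans; [apply Cmod_csum_le|].
apply Rle_trans with (rsum (2 * N) (fun _ => coef_sum M c i * (/ (2 * INR N * r) * T))).
- apply rsum_le; intros j _. fold (node N j).
  replace (Cminus _ _) with (Cmult (bandlim M c (node N j) i) (Cmult (sN N (x - node N j))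
    (Cminus (Gsigma sigma (x - node N j)) (Grsigma r sigma (x - node N j))))) by ring.
  rewrite !Cmod_mult. apply Rmult_le_compat.
  + apply Cmod_ge_0.
  + apply Rmult_le_pos; apply Cmod_ge_0.
  + apply Cmod_bandlim_le.
  + apply truncation_term; assumption.
- rewrite rsum_const, mult_INR. simpl (INR 2). right. field. lra.
Qed.

Lemma pointwise_error (N M : nat) (c : Z -> nat -> C) (alpha beta x : R) (i : nat) :
  (M < N)%nat ->
  let sigma := Rpower (INR N - INR M) beta / (sqrt 6 * PI) in
  let r := 3 * PI / Rpower (INR N - INR M) alpha in
  0 < beta ->
  Cmod (Cminus (bandlim M c x i) (recon N r sigma (bandlim M c) x i)) <=
  coef_sum M c i * ((1 + theta_const 3) * Etilde N M alpha beta).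
Proof.
intros HMN. rewrite <- (minus_INR N M) by lia. intros sigma r Hbeta.
assert (HP := PI2_3_2). assert (HP3 : 3 < PI) by lra. clear HP.
assert (HPP : 9 < PI ^ 2) by nra.
assert (Hd1 : 1 <= INR (N - M)) by (apply (le_INR 1); lia).
unfold Etilde. cbv zeta.
rewrite <- (minus_INR N M) by lia.
set (d := INR (N - M)) in *.
set (D := Rpower d beta) in *. set (A := Rpower d alpha) in *.
set (X1 := Rpower d (2 * (1 - beta))). set (X2 := Rpower d (2 * beta - 1)).
set (X4 := Rpower d (2 * (beta - alpha))).
assert (HD : 0 < D) by apply exp_pos. assert (HA : 0 < A) by apply exp_pos.
assert (HX2 : 0 < X2) by apply exp_pos.
assert (HD1 : 1 <= D).
{ unfold D. rewrite <- (Rpower_O d) by lra. apply Rle_Rpower; lra. }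
assert (E1 : X1 = d ^ 2 / D ^ 2).
{ apply Rmult_eq_reg_r with (D * D); [|nra].
  replace (d ^ 2 / D ^ 2 * (D * D)) with (d ^ 2) by (field; lra).
  unfold X1, D. rewrite <- !Rpower_plus. rewrite <- (Rpower_pow 2) by lra. f_equal. simpl; ring. }
assert (E2 : X2 = D ^ 2 / d).
{ apply Rmult_eq_reg_r with d; [|lra].
  replace (D ^ 2 / d * d) with (D * D) by (field; lra).
  rewrite <- (Rpower_1 d) at 1 by lra. unfold X2, D. rewrite <- !Rpower_plus. f_equal. ring. }
assert (E4 : X4 = D ^ 2 / A ^ 2).
{ apply Rmult_eq_reg_r with (A * A); [|nra].
  replace (D ^ 2 / A ^ 2 * (A * A)) with (D * D) by (field; lra).
  unfold X4, D, A. rewrite <- !Rpower_plus. f_equal. ring. }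
rewrite Rpower_plus. fold A D.
(* Forced by sigma^2 = D^2/(6 pi^2) and 1/(2 sigma^2) = pi^2 tau. Since D >= 1, tau <= 3, so
   [theta_const 3] serves all N. *)
set (tau := 3 / D ^ 2).
assert (HD2 : 1 <= D ^ 2) by nra.
assert (Htau : 0 < tau) by (apply Rdiv_lt_0_compat; lra).
assert (Htau3 : tau <= 3).
{ unfold tau. apply Rle_div_l; nra. }
assert (Hs6 : sqrt 6 * sqrt 6 = 6) by (apply sqrt_sqrt; lra).
assert (Hs60 : 0 < sqrt 6) by (apply sqrt_lt_R0; lra).
assert (Hsig : 0 < sigma) by (apply Rdiv_lt_0_compat; [lra|apply Rmult_lt_0_compat; lra]).
assert (Hr : 0 < r) by (apply Rdiv_lt_0_compat; lra).
assert (Hst : / (2 * sigma ^ 2) = PI ^ 2 * tau).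
{ assert (Hsig2 : sigma ^ 2 = D ^ 2 / (6 * PI ^ 2)).
  { rewrite <- Hs6. unfold sigma. field. lra. }
  rewrite Hsig2. unfold tau. field. lra. }
assert (H1 := untruncated_error N M c sigma x i Hsig HMN). cbv zeta in H1. fold d in H1.
assert (H2 := truncation_error N M c tau sigma r x i ltac:(lia) Htau Hr Hsig Hst).
rewrite Hst in H1.
set (mid := csum (2 * N) _) in *.
replace (Cminus (bandlim M c x i) (recon N r sigma (bandlim M c) x i))
  with (Cplus (Cminus (bandlim M c x i) mid) (Cminus mid (recon N r sigma (bandlim M c) x i))) by ring.
eapply Rle_trans; [apply Cmod_triangle|].
eapply Rle_trans; [apply Rplus_le_compat; [exact H1|exact H2]|].
rewrite <- Rmult_plus_distr_l. apply Rmult_le_compat_l; [apply coef_sum_pos|].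
assert (HC3 := theta_const_pos 3 ltac:(lra)).
assert (HC := theta_const_pos tau Htau).
assert (HCle := theta_const_incr tau 3 Htau Htau3).
set (F1 := exp (- 3 * PI ^ 2 * X1)). set (F2 := exp (- 3 * PI ^ 2 * X4)).
assert (HF1 : 0 < F1) by apply exp_pos. assert (HF2 : 0 < F2) by apply exp_pos.
(* The prefactor equals X2 * 4/(6 pi^2), hence is at most X2. *)
assert (B1 : 4 * exp (- (PI ^ 2 * tau * d ^ 2)) / (2 * (PI ^ 2 * tau) * d) <= F1 * Rmax 1 X2).
{ replace (exp (- (PI ^ 2 * tau * d ^ 2))) with F1.
  2: { unfold F1. f_equal. rewrite E1. unfold tau. field. lra. }
  replace (4 * F1 / (2 * (PI ^ 2 * tau) * d)) with (F1 * (X2 * (4 / (6 * PI ^ 2)))).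
  2: { rewrite E2. unfold tau. field. lra. }
  apply Rmult_le_compat_l; [lra|]. apply Rle_trans with X2; [|apply Rmax_r].
  assert (4 / (6 * PI ^ 2) <= 1) by (apply Rle_div_l; lra).
  nra. }
(* Here 1/r = A/(3 pi) and sqrt(1/(2 tau)) = D/sqrt 6; the exponent is r^2/tau = 3 pi^2 D^2/A^2. *)
assert (B2 : / r * (sqrt (/ (2 * tau)) * exp (- (r ^ 2 / tau)) * theta_const tau)
   <= theta_const 3 * (A * D * F2)).
{ replace (exp (- (r ^ 2 / tau))) with F2.
  2: { unfold F2. f_equal. rewrite E4. unfold r, tau. field. lra. }
  assert (Hsq : sqrt (/ (2 * tau)) <= D).
  { rewrite <- (sqrt_pow2 D) at 1 by lra. apply sqrt_le_1_alt.
    replace (/ (2 * tau)) with (D ^ 2 / 6) by (unfold tau; field; lra). lra. }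
  assert (Hri : / r <= A).
  { unfold r. replace (/ (3 * PI / A)) with (A / (3 * PI)) by (field; lra).
    apply Rle_div_l; nra. }
  assert (Hri0 : 0 < / r) by (apply Rinv_0_lt_compat, Hr).
  assert (Hsq0 := sqrt_pos (/ (2 * tau))).
  replace (theta_const 3 * (A * D * F2)) with (A * (D * F2 * theta_const 3)) by ring.
  assert (0 <= sqrt (/ (2 * tau)) * F2) by (apply Rmult_le_pos; lra).
  apply Rmult_le_compat; [lra| |exact Hri|].
  - apply Rmult_le_pos; lra.
  - apply Rmult_le_compat; try lra. apply Rmult_le_compat_r; lra. }
assert (0 <= A * D * F2) by (apply Rmult_le_pos; [apply Rmult_le_pos|]; lra).
assert (0 <= F1 * Rmax 1 X2) by (apply Rmult_le_pos; [lra|]; assert (1 <= Rmax 1 X2) by apply Rmax_l; lra).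
nra.
Qed.

(** * Integrability and passage to the L2 norm *)

Definition ccontinuous (f : R -> C) : Prop :=
  forall x, continuous (fun y => fst (f y)) x /\ continuous (fun y => snd (f y)) x.

Lemma ccontinuous_const z : ccontinuous (fun _ => z).
Proof. intros x; split; apply continuous_const. Qed.

Lemma ccontinuous_minus f g : ccontinuous f -> ccontinuous g ->
  ccontinuous (fun x => Cminus (f x) (g x)).
Proof.
intros Hf Hg x. destruct (Hf x) as [H1 H2], (Hg x) as [H3 H4].
split; simpl; apply (@continuous_minus R_UniformSpace R_AbsRing R_NormedModule); assumption.
Qed.

Lemma ccontinuous_plus f g : ccontinuous f -> ccontinuous g ->
  ccontinuous (fun x => Cplus (f x) (g x)).
Proof.
intros Hf Hg x. destruct (Hf x) as [H1 H2], (Hg x) as [H3 H4].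
split; simpl; apply (@continuous_plus R_UniformSpace R_AbsRing R_NormedModule); assumption.
Qed.

Lemma ccontinuous_mult f g : ccontinuous f -> ccontinuous g ->
  ccontinuous (fun x => Cmult (f x) (g x)).
Proof.
intros Hf Hg x. destruct (Hf x) as [H1 H2], (Hg x) as [H3 H4].
split; simpl.
- apply (@continuous_minus R_UniformSpace R_AbsRing R_NormedModule);
  apply (@continuous_mult R_UniformSpace R_AbsRing); assumption.
- apply (@continuous_plus R_UniformSpace R_AbsRing R_NormedModule);
  apply (@continuous_mult R_UniformSpace R_AbsRing); assumption.
Qed.

Lemma ccontinuous_csum n (f : nat -> R -> C) : (forall l, ccontinuous (f l)) ->
  ccontinuous (fun x => csum n (fun l => f l x)).
Proof.
intros H. induction n as [|n IH].
- apply (ccontinuous_const (RtoC 0)).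
- assert (Hs := ccontinuous_plus _ _ IH (H n)). intros x. destruct (Hs x) as [H1 H2].
  split.
  + eapply continuous_ext; [|exact H1]. intros y; cbv beta; rewrite csum_S; reflexivity.
  + eapply continuous_ext; [|exact H2]. intros y; cbv beta; rewrite csum_S; reflexivity.
Qed.

Lemma continuous_rsum n (f : nat -> R -> R) : (forall l x, continuous (f l) x) ->
  forall x, continuous (fun y => rsum n (fun l => f l y)) x.
Proof.
intros H x. induction n as [|n IH].
- apply (continuous_const 0).
- eapply continuous_ext; [intros y; symmetry; apply rsum_S|].
  apply (@continuous_plus R_UniformSpace R_AbsRing R_NormedModule); [exact IH|apply H].
Qed.

Lemma continuous_lipschitz (f : R -> R) L x : 0 <= L ->
  (forall y, Rabs (f y - f x) <= L * Rabs (y - x)) -> continuous f x.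
Proof.
intros HL H. apply filterlim_locally. intros eps.
assert (He := cond_pos eps).
assert (Hd : 0 < eps / (L + 1)) by (apply Rdiv_lt_0_compat; lra).
exists (mkposreal _ Hd). intros y Hy. change (Rabs (f y - f x) < eps).
change (Rabs (y - x) < eps / (L + 1)) in Hy.
eapply Rle_lt_trans; [apply H|].
assert (H0 := Rabs_pos (y - x)).
apply Rmult_lt_compat_r with (r := L + 1) in Hy; [|lra].
unfold Rdiv in Hy. rewrite Rmult_assoc, Rinv_l in Hy by lra. nra.
Qed.

Lemma ccontinuous_lipschitz (f : R -> C) L : 0 <= L ->
  (forall x y, Cmod (Cminus (f y) (f x)) <= L * Rabs (y - x)) -> ccontinuous f.
Proof.
intros HL H x. split; apply continuous_lipschitz with L; try exact HL; intros y;
  (eapply Rle_trans; [|apply H]); (eapply Rle_trans; [|apply Rmax_Cmod]).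
- apply (Rmax_l (Rabs (fst (Cminus (f y) (f x))))).
- apply (Rmax_r _ (Rabs (snd (Cminus (f y) (f x))))).
Qed.

Lemma Rabs_sin_le t : Rabs (sin t) <= Rabs t.
Proof.
assert (H : forall u, 0 < u -> Rabs (sin u) <= u).
{ intros u Hu. destruct (Rle_dec 1 u) as [H1|H1].
  - eapply Rle_trans; [apply Rabs_le, SIN_bound|exact H1].
  - assert (HP := PI2_3_2).
    rewrite Rabs_pos_eq; [apply Rlt_le, sin_lt_x, Hu|apply sin_ge_0; lra]. }
destruct (Rtotal_order t 0) as [Ht|[->|Ht]].
- rewrite <- (Rabs_Ropp t), <- (Rabs_Ropp (sin t)), <- sin_neg, (Rabs_pos_eq (- t)) by lra.
  apply H; lra.
- rewrite sin_0; lra.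
- rewrite (Rabs_pos_eq t) by lra. apply H, Ht.
Qed.

Lemma cis_lipschitz s t : Cmod (Cminus (cis t) (cis s)) <= Rabs (t - s).
Proof.
replace (Cminus (cis t) (cis s)) with (Cmult (Copp (cis s)) (Cminus (RtoC 1) (cis (t - s)))).
- rewrite Cmod_mult, Cmod_opp, Cmod_cis, Cmod_1_minus_cis.
  assert (H := Rabs_sin_le ((t - s) / 2)).
  unfold Rdiv in H at 2. rewrite Rabs_mult, (Rabs_pos_eq (/ 2)) in H by lra. lra.
- replace t with (s + (t - s)) at 2 by ring. rewrite cis_plus. ring.
Qed.

Lemma ccontinuous_cis b e : ccontinuous (fun x => cis (b * (x - e))).
Proof.
apply ccontinuous_lipschitz with (Rabs b); [apply Rabs_pos|].
intros x y. eapply Rle_trans; [apply cis_lipschitz|].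
rewrite <- Rabs_mult. right. f_equal. ring.
Qed.

(** The term of index n has Lipschitz constant 2 pi |n| e^{-a n^2}; these are summable, and a
    Lipschitz bound common to all partial sums survives the limit. *)
Lemma ccontinuous_theta a e : 0 < a -> ccontinuous (fun x => theta a (x - e)).
Proof.
intros Ha.
set (q := exp (- 1)). assert (Hq : 0 <= q < 1) by apply exp_m1_bound.
set (B := exp (/ a)). assert (HB : 0 < B) by apply exp_pos.
assert (HP := PI_RGT_0).
assert (HT : 0 <= 2 * B * (q / (1 - q))).
{ apply Rmult_le_pos; [lra|]. apply Rmult_le_pos; [lra|]. apply Rlt_le, Rinv_0_lt_compat; lra. }
apply ccontinuous_lipschitz with (2 * PI * (2 * B * (q / (1 - q)))).
{ apply Rmult_le_pos; lra. }
intros x y. set (D := Rabs (y - x)). assert (HD : 0 <= D) by apply Rabs_pos.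
apply climc_Cmod_le with (v := fun _ => 2 * PI * (2 * B * (q / (1 - q))) * D)
  (u := fun K => Cminus (zpartial (theta_term a (y - e)) K) (zpartial (theta_term a (x - e)) K)).
- apply climc_minus; apply climc_theta, Ha.
- apply is_lim_seq_const.
- exists 0%nat. intros K _.
  unfold zpartial. rewrite <- csum_minus.
  fold (zpartial (fun n => Cminus (theta_term a (y - e) n) (theta_term a (x - e) n)) K).
  eapply Rle_trans; [apply Cmod_zpartial_le|].
  set (w := fun n => Cmod _).
  assert (Hw : forall n, w n <= 2 * PI * D * (Rabs (IZR n) * exp (- (a * IZR n ^ 2)))).
  { intros n. unfold w, theta_term.
    replace (Cminus _ _) with (Cmult (RtoC (exp (- (a * IZR n ^ 2))))
      (Cminus (cis (2 * PI * IZR n * (y - e))) (cis (2 * PI * IZR n * (x - e))))) by ring.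
    rewrite Cmod_mult, Cmod_R, Rabs_pos_eq by apply Rlt_le, exp_pos.
    assert (H := cis_lipschitz (2 * PI * IZR n * (x - e)) (2 * PI * IZR n * (y - e))).
    replace (2 * PI * IZR n * (y - e) - 2 * PI * IZR n * (x - e))
      with (2 * PI * (IZR n * (y - x))) in H by ring.
    rewrite (Rabs_mult (2 * PI)), (Rabs_mult (IZR n)), (Rabs_pos_eq (2 * PI)) in H by lra. fold D in H.
    replace (2 * PI * D * (Rabs (IZR n) * exp (- (a * IZR n ^ 2))))
      with (exp (- (a * IZR n ^ 2)) * (2 * PI * (Rabs (IZR n) * D))) by ring.
    apply Rmult_le_compat_l; [apply Rlt_le, exp_pos|exact H]. }
  assert (H := rzpartial_geom_tail w (2 * PI * D * B) q 0 K ltac:(lia) Hq).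
  assert (H0 : w 0%Z <= 0).
  { eapply Rle_trans; [apply Hw|]. rewrite Rabs_R0. lra. }
  rewrite rzpartial_0 in H.
  assert (H' : rzpartial w K - w 0%Z <= 2 * (2 * PI * D * B) * (q / (1 - q)) * (q ^ 0 - q ^ K)).
  { apply H. intros n _. eapply Rle_trans; [apply Hw|].
    rewrite (Rmult_assoc (2 * PI * D)). apply Rmult_le_compat_l; [apply Rmult_le_pos; lra|].
    eapply Rle_trans; [|apply gauss_linear_le_geom, Ha].
    apply Rmult_le_compat_r; [apply Rlt_le, exp_pos|lra]. }
  assert (HqK : 0 <= q ^ K) by (apply pow_le; lra). simpl pow in H'.
  replace (2 * (2 * PI * D * B) * (q / (1 - q)) * (1 - q ^ K))
    with (2 * PI * (2 * B * (q / (1 - q))) * D * (1 - q ^ K)) in H' by ring.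
  assert (0 <= 2 * PI * (2 * B * (q / (1 - q))) * D)
    by (apply Rmult_le_pos; [apply Rmult_le_pos|]; lra). nra.
Qed.

Lemma continuous_Cmod2 f : ccontinuous f -> forall x, continuous (fun y => Cmod (f y) ^ 2) x.
Proof.
intros H x. destruct (H x) as [H1 H2].
assert (E : forall y, fst (f y) * fst (f y) + snd (f y) * snd (f y) = Cmod (f y) ^ 2).
{ intros y. unfold Cmod. rewrite pow2_sqrt; [ring|nra]. }
apply (continuous_ext _ _ x E).
apply (@continuous_plus R_UniformSpace R_AbsRing R_NormedModule);
  apply (@continuous_mult R_UniformSpace R_AbsRing); assumption.
Qed.

Lemma ccontinuous_bandlim M c i : ccontinuous (fun x => bandlim M c x i).
Proof.
unfold bandlim. apply ccontinuous_csum with (f := fun l x => Cmult (c (Z.of_nat l - Z.of_nat M)%Z i)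
  (cis (2 * PI * IZR (Z.of_nat l - Z.of_nat M) * x))). intros l.
apply ccontinuous_mult; [apply ccontinuous_const|].
intros x. destruct (ccontinuous_cis (2 * PI * IZR (Z.of_nat l - Z.of_nat M)) 0 x) as [H1 H2].
split; [eapply continuous_ext; [|exact H1]|eapply continuous_ext; [|exact H2]];
  intros y; simpl; rewrite Rminus_0_r; reflexivity.
Qed.

Lemma ccontinuous_sN N e : ccontinuous (fun x => sN N (x - e)).
Proof.
unfold sN. apply ccontinuous_mult; [apply ccontinuous_const|].
apply ccontinuous_csum with (f := fun l x => cis (2 * PI * IZR (Z.of_nat l - Z.of_nat N) * (x - e))).
intros l. apply ccontinuous_cis.
Qed.

Lemma ccontinuous_Gsigma sigma e : 0 < sigma -> ccontinuous (fun x => Gsigma sigma (x - e)).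
Proof.
intros Hs.
assert (H : ccontinuous (fun x => Cmult (RtoC (csigma sigma)) (theta (/ (2 * sigma ^ 2)) (x - e)))).
{ apply ccontinuous_mult; [apply ccontinuous_const|]. apply ccontinuous_theta.
  apply Rinv_0_lt_compat. assert (0 < sigma ^ 2) by (apply pow_lt, Hs). lra. }
intros x. destruct (H x) as [H1 H2].
split; [eapply continuous_ext; [|exact H1]|eapply continuous_ext; [|exact H2]];
  intros y; unfold Gsigma; rewrite gauss_series_theta by exact Hs; reflexivity.
Qed.

(* Only finitely many cut points are allowed, so [g] is piecewise continuous up to its
   values at the cuts; induction on the list splits the interval at one cut at a time. *)
Lemma ex_RInt_cuts (l : list R) (g : R -> R) (a b : R) : a <= b ->
  (forall p q, a <= p -> p < q -> q <= b -> (forall z, In z l -> ~ (p < z < q)) ->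
     exists h, (forall x, continuous h x) /\ (forall x, p < x < q -> g x = h x)) ->
  ex_RInt g a b.
Proof.
revert a b; induction l as [|z l IH]; intros a b Hab H.
- destruct Hab as [Hab| ->]; [|apply ex_RInt_point].
  destruct (H a b) as [h [Hh1 Hh2]]; try lra; [intros z []|].
  apply ex_RInt_ext with h.
  + intros x Hx. rewrite Rmin_left, Rmax_right in Hx by lra. symmetry; apply Hh2, Hx.
  + apply (@ex_RInt_continuous R_CompleteNormedModule). intros; apply Hh1.
- destruct (excluded_middle_informative (a < z < b)) as [Hz|Hz].
  + apply ex_RInt_Chasles with z; apply IH; try lra; intros p q H1 H2 H3 H4; apply H; try lra;
      intros t [<-|Ht]; try lra; apply H4, Ht.
  + apply IH; [exact Hab|]. intros p q H1 H2 H3 H4. apply H; try lra.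
    intros t [<-|Ht]; [lra|apply H4, Ht].
Qed.

(** The integrand can jump only where some x - x_j is at distance exactly r from an integer. Between
    consecutive such points each truncated kernel is either the full Gaussian or zero. *)
Lemma ex_RInt_error (m N M : nat) (c : Z -> nat -> C) (r sigma : R) :
  (0 < N)%nat -> 0 < sigma ->
  ex_RInt (fun x => rsum m (fun i =>
    Cmod (Cminus (bandlim M c x i) (recon N r sigma (bandlim M c) x i)) ^ 2)) 0 1.
Proof.
intros HN Hs. assert (HN' : 0 < INR N) by (apply lt_0_INR, HN).
(* As x and the nodes lie in [0,1], an integer within r of x - x_j has modulus at most r + 1. *)
set (Q := (Z.to_nat (up r) + 2)%nat).
set (cuts := flat_map (fun j => flat_map (fun t =>
   let k := IZR (Z.of_nat t - Z.of_nat Q) in (node N j + k + r) :: (node N j + k - r) :: nil)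
   (seq 0 (2 * Q + 1))) (seq 0 (2 * N))).
apply (ex_RInt_cuts cuts); [lra|]. intros p q Hp Hpq Hq Hcut.
set (near := fun j x => exists k : Z, Rabs (x - node N j - IZR k) <= r).
(* If x is in a window and z is not, an end of this window lies between them, which would be a cut
   inside (p,q). The midpoint can thus decide for the whole interval. *)
assert (Hnear : forall j x z, (j < 2 * N)%nat -> p < x < q -> p < z < q -> near j x -> near j z).
{ intros j x z Hj Hx Hz [k Hk]. exists k. apply Rnot_lt_le. intros Hf.
  assert (Hnode : 0 <= node N j <= 1).
  { apply (lt_INR j) in Hj. rewrite mult_INR in Hj. simpl (INR 2) in Hj. unfold node. split.
    - apply Rmult_le_pos; [apply pos_INR|apply Rlt_le, Rinv_0_lt_compat; lra].
    - apply Rle_div_l; lra. }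
  apply Rabs_le_between in Hk.
  assert (HkQ : (Z.abs k <= Z.of_nat Q)%Z).
  { destruct (archimed r) as [Hu _].
    assert (IZR k < IZR (up r + 2)) by (rewrite plus_IZR; lra).
    assert (IZR (- (up r + 2)) < IZR k) by (rewrite opp_IZR, plus_IZR; lra).
    apply lt_IZR in H, H0. unfold Q. lia. }
  assert (Hin : forall w, w = node N j + IZR k + r \/ w = node N j + IZR k - r -> In w cuts).
  { intros w Hw. apply in_flat_map. exists j. split; [apply in_seq; lia|].
    apply in_flat_map. exists (Z.to_nat (k + Z.of_nat Q)). split; [apply in_seq; lia|].
    replace (Z.of_nat (Z.to_nat (k + Z.of_nat Q)) - Z.of_nat Q)%Z with k by lia.
    simpl. destruct Hw as [->| ->]; auto. }
  destruct (Rle_dec (z - node N j - IZR k) r) as [H1|H1].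
  - apply (Hcut (node N j + IZR k - r)); [apply Hin; auto|].
    assert (z - node N j - IZR k < - r).
    { apply Rnot_le_lt. intros H2. apply Rlt_not_le in Hf. apply Hf, Rabs_le. lra. }
    lra.
  - apply (Hcut (node N j + IZR k + r)); [apply Hin; auto|]. lra. }
set (mid := (p + q) / 2).
exists (fun x => rsum m (fun i => Cmod (Cminus (bandlim M c x i)
   (csum (2 * N) (fun j => Cmult (bandlim M c (node N j) i) (Cmult (sN N (x - node N j))
     (if excluded_middle_informative (near j mid) then Gsigma sigma (x - node N j) else RtoC 0))))) ^ 2)).
split.
- apply continuous_rsum with (f := fun i x => Cmod (Cminus (bandlim M c x i)
   (csum (2 * N) (fun j => Cmult (bandlim M c (node N j) i) (Cmult (sN N (x - node N j))
     (if excluded_middle_informative (near j mid) then Gsigma sigma (x - node N j) else RtoC 0))))) ^ 2).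
  intros i x. apply continuous_Cmod2. apply ccontinuous_minus; [apply ccontinuous_bandlim|].
  apply ccontinuous_csum with (f := fun j x => Cmult (bandlim M c (node N j) i) (Cmult (sN N (x - node N j))
     (if excluded_middle_informative (near j mid) then Gsigma sigma (x - node N j) else RtoC 0))).
  intros j. apply ccontinuous_mult; [apply ccontinuous_const|].
  apply ccontinuous_mult; [apply ccontinuous_sN|].
  destruct (excluded_middle_informative _); [apply ccontinuous_Gsigma, Hs|apply ccontinuous_const].
- intros x Hx. apply rsum_ext; intros i _. do 3 f_equal.
  unfold recon. apply csum_ext; intros j Hj. cbv zeta. fold (node N j). do 2 f_equal.
  unfold Grsigma. fold (near j x).
  assert (Hmid : p < mid < q) by (unfold mid; lra).
  destruct (excluded_middle_informative (near j x)) as [H1|H1];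
  destruct (excluded_middle_informative (near j mid)) as [H2|H2]; try reflexivity; exfalso.
  + apply H2, (Hnear j x mid); assumption.
  + apply H1, (Hnear j mid x); assumption.
Qed.

Lemma RInt_eq_0_continuous (phi : R -> R) : (forall x, continuous phi x) ->
  (forall x, 0 <= phi x) -> RInt phi 0 1 = 0 -> forall x, 0 <= x <= 1 -> phi x = 0.
Proof.
intros Hc Hpos H x Hx. apply Rle_antisym; [|apply Hpos]. apply Rnot_lt_le. intros Hlt.
assert (Hex : forall a b, ex_RInt phi a b)
  by (intros; apply (@ex_RInt_continuous R_CompleteNormedModule); intros; apply Hc).
destruct (proj1 (filterlim_locally _ _) (Hc x) (mkposreal _ Hlt)) as [delta Hd].
assert (Hdelta := cond_pos delta).
(* Clipping to [0,1] keeps a nondegenerate interval even when x is an endpoint; on it the integrand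
   is positive. *)
set (p := Rmax 0 (x - delta / 2)). set (q := Rmin 1 (x + delta / 2)).
assert (Hp1 : 0 <= p) by apply Rmax_l. assert (Hp2 : x - delta / 2 <= p) by apply Rmax_r.
assert (Hp3 : p <= x) by (apply Rmax_lub; lra).
assert (Hq1 : q <= 1) by apply Rmin_l. assert (Hq2 : q <= x + delta / 2) by apply Rmin_r.
assert (Hq3 : x <= q) by (apply Rmin_glb; lra).
assert (Hpq : p < q).
{ unfold p, q. apply Rmax_lub_lt; apply Rmin_glb_lt; lra. }
assert (0 < RInt phi p q).
{ apply RInt_gt_0; [exact Hpq| |intros; apply Hc]. intros y Hy.
  assert (Hb : ball x delta y) by (change (Rabs (y - x) < delta); apply Rabs_def1; lra).
  apply Hd in Hb. change (Rabs (phi y - phi x) < phi x) in Hb.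
  apply Rabs_def2 in Hb. lra. }
assert (0 <= RInt phi 0 p) by (apply RInt_ge_0; auto).
assert (0 <= RInt phi q 1) by (apply RInt_ge_0; auto).
rewrite <- (RInt_Chasles phi 0 p 1), <- (RInt_Chasles phi p q 1) in H by apply Hex.
unfold plus in H; simpl in H. lra.
Qed.

Lemma continuous_L2_integrand m M c x :
  continuous (fun x => rsum m (fun i => Cmod (bandlim M c x i) ^ 2)) x.
Proof.
apply continuous_rsum with (f := fun i x => Cmod (bandlim M c x i) ^ 2).
intros i y. apply continuous_Cmod2, ccontinuous_bandlim.
Qed.

Lemma bandlim_L2norm_eq_0 m M c : L2norm m (bandlim M c) = 0 ->
  forall x i, 0 <= x <= 1 -> (i < m)%nat -> bandlim M c x i = RtoC 0.
Proof.
intros H x i Hx Hi.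
assert (Hpos : forall y l, 0 <= Cmod (bandlim M c y l) ^ 2) by (intros; apply pow2_ge_0).
assert (H0 := RInt_eq_0_continuous _ (continuous_L2_integrand m M c)
  ltac:(intros; apply rsum_pos; intros; apply Hpos)).
assert (Hsum : rsum m (fun l => Cmod (bandlim M c x l) ^ 2) = 0).
{ apply H0; [|exact Hx]. apply sqrt_eq_0; [|exact H].
  apply RInt_ge_0; [lra| |intros; apply rsum_pos; intros; apply Hpos].
  apply (@ex_RInt_continuous R_CompleteNormedModule). intros; apply continuous_L2_integrand. }
apply Cmod_eq_0.
assert (Hle := rsum_term_le m (fun l => Cmod (bandlim M c x l) ^ 2) i Hi ltac:(intros; apply Hpos)).
cbv beta in Hle. rewrite Hsum in Hle. assert (Hp := Cmod_ge_0 (bandlim M c x i)). nra.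
Qed.

Lemma L2norm_le m (g : R -> nat -> C) (b : nat -> R) (kappa : R) : 0 <= kappa ->
  ex_RInt (fun x => rsum m (fun i => Cmod (g x i) ^ 2)) 0 1 ->
  (forall x i, Cmod (g x i) <= b i * kappa) ->
  L2norm m g <= kappa * sqrt (rsum m (fun i => b i ^ 2)).
Proof.
intros Hk Hex H. unfold L2norm.
rewrite <- (sqrt_pow2 kappa Hk) at 1. rewrite <- sqrt_mult_alt by apply pow2_ge_0.
apply sqrt_le_1_alt. rewrite <- rsum_scal.
set (B := rsum m _).
assert (HB : RInt (fun _ => B) 0 1 = B).
{ rewrite RInt_const. unfold scal; simpl; unfold mult; simpl. ring. }
rewrite <- HB.
apply RInt_le; [lra|exact Hex|apply ex_RInt_const|].
intros x _. apply rsum_le; intros i _.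
rewrite Rmult_comm, <- Rpow_mult_distr. apply pow_incr. split; [apply Cmod_ge_0|apply H].
Qed.

Theorem theorem3p1 (m M : nat) (c : Z -> nat -> C) (alpha beta : R) :
  0 < alpha -> alpha < beta -> beta < 1 ->
  exists K : R, K > 0 /\
  exists N0 : nat, forall N : nat, (N0 <= N)%nat -> (M < N)%nat ->
    let sigma := Rpower (INR N - INR M) beta / (sqrt 6 * PI) in
    let r := 3 * PI / Rpower (INR N - INR M) alpha in
    L2norm m (fun x i => Cminus (bandlim M c x i) (recon N r sigma (bandlim M c) x i))
    <= K * Etilde N M alpha beta * L2norm m (bandlim M c).
Proof.
intros Ha Hab Hb1.
assert (HE : forall N, 0 <= Etilde N M alpha beta).
{ intros N. unfold Etilde. cbv zeta. apply Rplus_le_le_0_compat; apply Rmult_le_pos;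
  try (apply Rlt_le, exp_pos). apply Rle_trans with 1; [lra|apply Rmax_l]. }
(* If the norm of [f] vanishes, so do the samples of [f]; otherwise the absolute sum of
   its Fourier coefficients is absorbed, relative to the norm, into [K]. *)
destruct (Req_dec (L2norm m (bandlim M c)) 0) as [H0|H0].
- exists 1. split; [lra|]. exists 0%nat. intros N _ HMN sigma r.
  rewrite H0, Rmult_0_r. right. unfold L2norm.
  rewrite (RInt_ext _ (fun _ => 0)).
  + rewrite RInt_const. unfold scal; simpl; unfold mult; simpl. rewrite Rmult_0_r. apply sqrt_0.
  + intros x Hx. rewrite Rmin_left, Rmax_right in Hx by lra.
    rewrite (rsum_ext m _ (fun _ => 0)); [rewrite rsum_const; apply Rmult_0_r|]. intros i Hi.
    assert (Hz := bandlim_L2norm_eq_0 m M c H0).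
    rewrite (Hz x i) by (lra || assumption). unfold recon. rewrite (csum_ext _ _ (fun _ => RtoC 0)).
    * rewrite csum_0. replace (Cminus (RtoC 0) (RtoC 0)) with (RtoC 0) by ring. rewrite Cmod_0. ring.
    * intros j Hj. cbv zeta. rewrite Hz; [ring| |exact Hi].
      assert (HN' : 0 < INR N) by (apply lt_0_INR; lia).
      apply (lt_INR j) in Hj. rewrite mult_INR in Hj. simpl (INR 2) in Hj. split.
      -- apply Rmult_le_pos; [apply pos_INR|apply Rlt_le, Rinv_0_lt_compat; lra].
      -- apply Rle_div_l; lra.
- assert (Hn : 0 < L2norm m (bandlim M c)).
  { assert (0 <= L2norm m (bandlim M c)) by apply sqrt_pos. lra. }
  set (nf := L2norm m (bandlim M c)) in *.
  assert (HC := theta_const_pos 3 ltac:(lra)).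
  set (A := sqrt (rsum m (fun i => coef_sum M c i ^ 2))).
  assert (HA : 0 <= A) by apply sqrt_pos.
  assert (HAn : 0 <= (1 + theta_const 3) * A / nf).
  { apply Rmult_le_pos; [apply Rmult_le_pos; lra|apply Rlt_le, Rinv_0_lt_compat, Hn]. }
  (* Dividing by the norm of f absorbs the coefficient sum; adding 1 makes the constant strictly
     positive from A >= 0 alone. The pointwise bounds hold for every N > M, whence the threshold
     0. *)
  exists ((1 + theta_const 3) * A / nf + 1). split; [lra|]. exists 0%nat. intros N _ HMN sigma r.
  apply Rle_trans with ((1 + theta_const 3) * Etilde N M alpha beta * A).
  + apply L2norm_le.
    * apply Rmult_le_pos; [lra|apply HE].
    * apply ex_RInt_error; [lia|]. unfold sigma.
      apply Rdiv_lt_0_compat; [apply exp_pos|]. apply Rmult_lt_0_compat; [apply sqrt_lt_R0; lra|apply PI_RGT_0].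
    * intros x i. apply pointwise_error; [exact HMN|lra].
  + assert (HEN := HE N).
    replace ((1 + theta_const 3) * Etilde N M alpha beta * A)
      with ((1 + theta_const 3) * A / nf * Etilde N M alpha beta * nf) by (field; lra).
    assert (0 <= Etilde N M alpha beta * nf) by (apply Rmult_le_pos; lra). nra.
Qed.
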